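(* Let $\beta$ be a nonzero complex number and let $\{B_n\}_{n\in\mathbb{N}}$ be the $\beta$ matrix-sequence with parameter $\beta$. (1) Assume $|\beta|\ge 1$. Then $\{B_n\}_{n\in\mathbb{N}}$ is distributed in the eigenvalue sense as $e^{\mathbf{i}\theta}$ on $[-\pi,\pi]$, i.e. for every continuous function $F:\mathbb{C}\to\mathbb{C}$ with bounded support, $$\lim_{n\to\infty}\frac1n\sum_{i=1}^{n}F(\lambda_i(B_n))=\frac1{2\pi}\int_{-\pi}^{\pi}F(e^{\mathbf{i}\theta})\,\mathrm{d}\theta .$$ (2) For any nonzero complex $\beta$, $\{B_n\}_{n\in\mathbb{N}}$ is distributed in the singular value sense as $1$ on $[-\pi,\pi]$, i.e. for every continuous function $F:[0,+\infty)\to\mathbb{C}$ with bounded support, $$\lim_{n\to\infty}\frac1n\sum_{i=1}^{n}F(\sigma_i(B_n))=\frac1{2\pi}\int_{-\pi}^{\pi}F(1)\,\mathrm{d}\theta=F(1).$$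
   Context: For $n\ge 1$ and a nonzero complex parameter $\beta$, let $e_1,\dots,e_n$ be the canonical basis of $\mathbb{C}^n$ (column vectors), $e=\sum_{j=1}^n e_j$ the all-ones vector, and $v\in\mathbb{C}^n$ the vector with entries $v_j=\beta^{-j}$, $j=1,\dots,n$. Let $T_n(e^{\mathbf{i}\theta})$ be the $n\times n$ matrix with $(s,t)$ entry equal to $1$ if $s-t=1$ and $0$ otherwise. The $\beta$ matrix of order $n$ is $$B_n=T_n(e^{\mathbf{i}\theta})+(v-e_1)e^{T},$$ i.e. the $(s,t)$ entry of $B_n$ is $\beta^{-s}-\delta_{s,1}+\delta_{s,t+1}$, where $\delta$ is the Kronecker delta. Here $\lambda_1(B_n),\dots,\lambda_n(B_n)$ are the eigenvalues of $B_n$ counted with algebraic multiplicity and $\sigma_1(B_n),\dots,\sigma_n(B_n)$ are its singular values counted with multiplicity; $\mathbf{i}^2=-1$. *)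

(* Defs.v *)
From HB Require Import structures.
From mathcomp Require Import all_boot all_order all_algebra.
From mathcomp Require Import complex.
From mathcomp Require Import all_classical all_reals all_analysis.

Set Implicit Arguments.
Unset Strict Implicit.
Unset Printing Implicit Defensive.

Import Order.TTheory GRing.Theory Num.Theory.
Import numFieldNormedType.Exports.

Local Open Scope classical_set_scope.
Local Open Scope sesquilinear_scope.
Local Open Scope complex_scope.
Local Open Scope ring_scope.

(* The usual topology of the complex plane, i.e. the one induced by the
   modulus. *)
HB.instance Definition _ (R : realType) := NormedModule.copy R[i] R[i]^o.

Section BetaMatrix.
Variables (R : realType) (n : nat).

(* Ordinals start at 0: the 1-based index s of the mathematical text is the
   successor of the ordinal, hence the exponent j.+1 in beta_vec. *)
Definition shift_mx : 'M[R[i]]_n := \matrix_(s, t) ((s == t.+1 :> nat)%:R).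

Definition beta_vec (beta : R[i]) : 'cV[R[i]]_n := \col_j beta ^- j.+1.

Definition first_vec : 'cV[R[i]]_n := \col_j ((j == 0 :> nat)%:R).

Definition ones_vec : 'cV[R[i]]_n := const_mx 1.

Definition beta_mx (beta : R[i]) : 'M[R[i]]_n :=
  shift_mx + (beta_vec beta - first_vec) *m ones_vec^T.

Lemma beta_mxE (beta : R[i]) (s t : 'I_n) :
  beta_mx beta s t =
  beta ^- s.+1 - (s == 0 :> nat)%:R + (s == t.+1 :> nat)%:R.
Proof. by rewrite !mxE big_ord1 !mxE mulr1 addrC. Qed.

End BetaMatrix.

Section Spectra.
Variable R : realType.

(* All the roots of the characteristic polynomial, with multiplicity. *)
Definition eigenvalues n (A : 'M[R[i]]_n) : seq R[i] :=
  sval (closed_field_poly_normal (char_poly A)).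

Lemma eigenvaluesP n (A : 'M[R[i]]_n) :
  char_poly A = \prod_(z <- eigenvalues A) ('X - z%:P).
Proof.
rewrite /eigenvalues; case: closed_field_poly_normal => r /= {1}->.
by rewrite (monicP (char_poly_monic A)) scale1r.
Qed.

Lemma size_eigenvalues n (A : 'M[R[i]]_n) : size (eigenvalues A) = n.
Proof.
by have := size_char_poly A; rewrite eigenvaluesP size_prod_XsubC => -[].
Qed.

(* The eigenvalues of A^* A are nonnegative reals, so that taking their real
   part only changes their type. *)
Definition singular_values n (A : 'M[R[i]]_n) : seq R :=
  [seq Num.sqrt (complex.Re z) | z <- eigenvalues (A ^t* *m A)].

End Spectra.

Section Distribution.
Variable R : realType.

Definition cexpi (t : R) : R[i] := cos t +i* sin t.

Definition Cintegral (D : set R) (f : R -> R[i]) : R[i] :=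
  (\int[lebesgue_measure]_(t in D) complex.Re (f t)) +i*
  (\int[lebesgue_measure]_(t in D) complex.Im (f t)).

(* (1 / 2 pi) * the integral of f over [-pi, pi] *)
Definition circle_mean (f : R -> R[i]) : R[i] :=
  ((2 * pi)^-1)%:C * Cintegral `[- pi, pi] f.

Definition eig_test (F : R[i] -> R[i]) : Prop :=
  continuous F /\ bounded_set (closure [set z | F z != 0]).

(* A function on [0, +oo) is represented by a function on R of which only the
   restriction to [0, +oo) is constrained and used. *)
Definition sv_test (F : R -> R[i]) : Prop :=
  {within `[0, +oo[, continuous F} /\
  bounded_set (closure [set x | 0 <= x /\ F x != 0]).

Definition eig_mean n (A : 'M[R[i]]_n) (F : R[i] -> R[i]) : R[i] :=
  n%:R^-1 * \sum_(z <- eigenvalues A) F z.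

Definition sv_mean n (A : 'M[R[i]]_n) (F : R -> R[i]) : R[i] :=
  n%:R^-1 * \sum_(x <- singular_values A) F x.

Definition eig_distributed (A : forall n, 'M[R[i]]_n) (f : R -> R[i]) : Prop :=
  forall F : R[i] -> R[i], eig_test F ->
    eig_mean (A n) F @[n --> \oo] --> circle_mean (fun t => F (f t)).

Definition sv_distributed (A : forall n, 'M[R[i]]_n) (f : R -> R[i]) : Prop :=
  forall F : R -> R[i], sv_test F ->
    sv_mean (A n) F @[n --> \oo] -->
    circle_mean (fun t => F (complex.Re `|f t|)).

End Distribution.

(* Main.v *)
Require Import Defs.
From mathcomp Require Import all_boot all_order all_algebra.
From mathcomp Require Import complex.
From mathcomp Require Import all_classical all_reals all_analysis.
From mathcomp Require Import ring lra zify.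

Set Implicit Arguments.
Unset Strict Implicit.
Unset Printing Implicit Defensive.

Import Order.TTheory GRing.Theory Num.Theory.
Import numFieldNormedType.Exports.

Local Open Scope classical_set_scope.
Local Open Scope complex_scope.
Local Open Scope ring_scope.

(** Singular values.  The Gram matrix of [beta_mx n beta] differs from the
    identity by a matrix of rank at most 3 ([rank_beta_gram]): the shift is an
    isometry up to one coordinate, and the perturbation has rank one.  Hence
    the eigenvalue 1 of the Gram matrix has algebraic multiplicity at least
    [n - 3] ([count_eigenvalues_rank], through the identity
    [det_scalar_sub_mulmx] of Sylvester), and all terms of the mean of [F]
    but at most three equal [F 1].

    Eigenvalues.  In the basis of partial sums of the canonical basis the
    transposed matrix is a companion matrix, so the characteristic polynomial
    is explicit ([char_poly_beta]): [X^n + \sum_(i < n) c_(i+1) X^i] with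
    [c_k = 1 - \sum_(1 <= j <= k) beta^-j].  When [1 <= |beta|] the
    coefficients grow at most linearly, the lower ones do not depend on [n],
    and the lowest nonzero one is [c_1], or [c_2] when [beta = 1].  Polynomials
    of this shape have equidistributed zeros, for three reasons.

    - Landau's inequality ([landau]) bounds the product of the zeros outside
      the unit disc by the 2-norm of the coefficients; the constant term
      transfers this to the zeros inside.  So the sum of [| ln |z| |] over the
      nonzero zeros is [O(ln n)] ([sum_abs_ln_roots]): most zeros are close to
      the circle.

    - Newton's identities ([newton_identity]), applied to the reciprocals of
      the zeros, involve only the coefficients of low degree.  Thus for each
      fixed [k] the sum of [z^-k] is bounded in [n], and, the zeros being
      close to the circle, the sum of [(z / |z|)^k] is [O(ln n)]
      ([unitc_moment_bound]).  Low order power sums are used on the side where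
      they stay bounded: for [beta = 1] one zero is close to [n], and the
      positive power sums are not bounded.

    - Two finite families of points of the circle whose first [N] moments are
      small have close means against every continuous function
      ([mean_discrepancy_small]).  This is an approximation argument with the
      kernel [|1 + u / w|^(2 N)], a nonnegative trigonometric polynomial
      that concentrates at [u = w].

    Comparing the normalized zeros with the [M]-th roots of [(-1)^M], whose
    moments of order below [M] vanish and whose means are Riemann sums
    ([circle_nodes_mean]), gives the integral over the circle
    ([zeros_mean_cvg]). *)

(** * The modulus of a complex number as a real number *)
Import Normc.

(** The norm of [R[i]] takes its values in [R[i]]; the real-valued [normc]
    gives access to the total order of [R], its logarithm and its topology. *)
Section Modulus.
Variable R : rcfType.
Implicit Types x y z : R[i].

Lemma normr_normc z : `|z| = (normc z)%:C.
Proof. by case: z. Qed.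

Lemma ltc_normc z (e : R) : (`|z| < e%:C) = (normc z < e).
Proof. by rewrite normr_normc ltcR. Qed.

Lemma normc_ge0 z : 0 <= normc z.
Proof. by rewrite -lecR -normr_normc normr_ge0. Qed.

Lemma normc_eq0 z : (normc z == 0) = (z == 0).
Proof. by apply/eqP/eqP => [/eq0_normc//|->]; rewrite normc0. Qed.

Lemma normc_gt0 z : (0 < normc z) = (z != 0).
Proof. by rewrite lt_def normc_ge0 andbT normc_eq0. Qed.

Lemma normcX z n : normc (z ^+ n) = normc z ^+ n.
Proof. by elim: n => [|n IH]; rewrite ?expr0 ?normc1 // !exprS normcM IH. Qed.

Lemma normc_prod (I : Type) (r : seq I) (F : I -> R[i]) :
  normc (\prod_(i <- r) F i) = \prod_(i <- r) normc (F i).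
Proof. exact: (big_morph _ (@normcM R) (normc1 R)). Qed.

Lemma normcD x y : normc (x + y) <= normc x + normc y.
Proof. by rewrite -lecR rmorphD /= -!normr_normc ler_normD. Qed.

Lemma normc_opp z : normc (- z) = normc z.
Proof. exact: normcN. Qed.

Lemma normc_sub x y : normc (x - y) = normc (y - x).
Proof. by rewrite -normc_opp opprB. Qed.

Lemma normc_sum (I : Type) (r : seq I) (P : pred I) (F : I -> R[i]) :
  normc (\sum_(i <- r | P i) F i) <= \sum_(i <- r | P i) normc (F i).
Proof.
elim/big_rec2: _ => [|i a b _ H]; first by rewrite normc0.
by apply: le_trans (normcD _ _) _; rewrite lerD2l.
Qed.

Lemma normc_real (a : R) : normc a%:C = `|a|.
Proof. by rewrite /normc /= expr0n addr0 sqrtr_sqr. Qed.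

Lemma normc_nat n : normc (n%:R : R[i]) = n%:R.
Proof. by rewrite -[n%:R](rmorph_nat (real_complex R)) normc_real normr_nat. Qed.

Lemma normc_conj z : normc z^*%C = normc z.
Proof. by case: z => a b; rewrite /= sqrrN. Qed.

Lemma normc_sqr z : normc z ^+ 2 = complex.Re z ^+ 2 + complex.Im z ^+ 2.
Proof. by case: z => a b; rewrite /= sqr_sqrtr // addr_ge0 // sqr_ge0. Qed.

Lemma mulcJ z : z * z^*%C = (normc z ^+ 2)%:C.
Proof. by rewrite -sqr_normc normr_normc rmorphXn. Qed.

Lemma ler_Re_normc z : `|complex.Re z| <= normc z.
Proof. by have := normc_ge_Re z; rewrite normr_normc lecR. Qed.

Lemma ler_Im_normc z : `|complex.Im z| <= normc z.
Proof.
by case: z => a b /=; rewrite -sqrtr_sqr ler_wsqrtr // lerDr sqr_ge0.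
Qed.

Lemma normc_le_ReIm z : normc z <= `|complex.Re z| + `|complex.Im z|.
Proof.
case: z => a b /=; rewrite -[leRHS]ger0_norm ?addr_ge0 // -(sqrtr_sqr (`|a| + `|b|)).
rewrite ler_wsqrtr // sqrrD !real_normK ?num_real //.
by rewrite lerD2r lerDl mulrn_wge0 // mulr_ge0.
Qed.

End Modulus.

(** * The characteristic polynomial of the beta matrix *)
Lemma char_poly_tr (F : comNzRingType) n (A : 'M[F]_n) :
  char_poly (A^T) = char_poly A.
Proof.
rewrite /char_poly -det_tr; congr (\det _).
by rewrite /char_poly_mx linearB /= tr_scalar_mx map_trmx trmxK.
Qed.

Lemma char_poly_similar (F : fieldType) n (A G K : 'M[F]_n) :
  G \in unitmx -> A *m G = G *m K -> char_poly A = char_poly K.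
Proof.
rewrite unitmxE unitfE => G0 AG.
have := congr1 (@determinant _ n)
  (_ : char_poly_mx A *m map_mx polyC G = map_mx polyC G *m char_poly_mx K).
rewrite /= !det_mulmx /char_poly => H.
have {}H : \det (char_poly_mx A) * (\det G)%:P =
           \det (char_poly_mx K) * (\det G)%:P.
  rewrite -!det_map_mx H 1?mulrC //.
  rewrite /char_poly_mx mulmxBl mulmxBr -!map_mxM AG.
  by rewrite scalar_mxC.
by apply: mulIf H; rewrite polyC_eq0.
Qed.

(** The size of [companionmx p] is only provably equal to [n]; here it is
    [n] by construction. *)
Lemma char_poly_companion (F : comNzRingType) n (p : {poly F}) :
  p \is monic -> size p = n.+1 ->
  char_poly (\matrix_(i < n, j < n)
    if (i == n.-1 :> nat) then - p`_j else (i.+1 == j :> nat)%:R) = p.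
Proof.
move=> pm sp; have -> : n = (size p).-1 by rewrite sp.
exact: companionmxK.
Qed.

Section CharPoly.
Variables (R : realType) (beta : R[i]).

Definition beta_coef (k : nat) : R[i] := 1 - \sum_(j < k) beta ^- j.+1.

Definition beta_poly (n : nat) : {poly R[i]} :=
  'X^n + \poly_(i < n) beta_coef i.+1.

Lemma size_beta_poly n : size (beta_poly n) = n.+1.
Proof. by rewrite size_polyDl size_polyXn // ltnS size_poly. Qed.

Lemma beta_poly_monic n : beta_poly n \is monic.
Proof.
by rewrite monicE lead_coefDl ?lead_coefXn // size_polyXn ltnS size_poly.
Qed.

Lemma coef_beta_poly n i :
  (beta_poly n)`_i = if (i < n)%N then beta_coef i.+1 else (i == n)%:R.
Proof.
rewrite coefD coefXn coef_poly.
by case: ltngtP; rewrite ?add0r ?addr0.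
Qed.

(** With [G] the matrix whose columns are the partial sums of the canonical
    basis, [B^T G = G K] for the companion matrix [K] of [beta_poly n]: the
    shift moves each partial sum to the previous one, and the rank one part
    contributes the partial sum of the [beta^-j] minus 1, constant along the
    column. *)
Lemma char_poly_beta n : char_poly (beta_mx n beta) = beta_poly n.
Proof.
case: n => [|n].
  by rewrite /char_poly det_mx00 /beta_poly expr0 poly_def big_ord0 addr0.
pose G : 'M[R[i]]_n.+1 := \matrix_(t, i) (t <= i)%N%:R.
rewrite -[LHS]char_poly_tr.
rewrite -[RHS](char_poly_companion (beta_poly_monic _) (size_beta_poly _)).
apply: (@char_poly_similar _ _ _ G).
  rewrite unitmxE -det_tr det_trig; last first.
    by apply/is_trig_mxP => i j ij; rewrite !mxE leqNgt ij.
  by rewrite big1 ?unitr1 // => i _; rewrite !mxE leqnn.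
apply/matrixP => t i; rewrite mxE [RHS]mxE.
under eq_bigr => s _ do rewrite [_^T _ _]mxE [G _ _]mxE beta_mxE.
under [RHS]eq_bigr => j _ do rewrite !mxE.
rewrite [RHS]big_ord_recr /= leq_ord mul1r eqxx coef_beta_poly ltn_ord.
rewrite /beta_coef opprB.
under eq_bigr => s _ do rewrite mulrDl mulrBl.
rewrite big_split sumrB /=.
have -> : \sum_(s < n.+1) beta ^- s.+1 * (s <= i)%N%:R =
          \sum_(j < i.+1) beta ^- j.+1.
  rewrite (big_ord_widen n.+1 (fun j => beta ^- j.+1)) // [RHS]big_mkcond /=.
  by apply: eq_bigr => s _; rewrite ltnS; case: leqP; rewrite ?mulr1 ?mulr0.
have -> : \sum_(s < n.+1) (s == 0 :> nat)%:R * (s <= i)%N%:R = 1 :> R[i].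
  by rewrite big_ord_recl /= mulr1 big1 ?addr0 // => s _; rewrite mul0r.
rewrite [RHS]addrC; congr (_ + _).
have -> : \sum_(s < n.+1) (s == t.+1 :> nat)%:R * (s <= i)%N%:R
   = (t < i)%N%:R :> R[i].
  have [ti|ti] := ltnP t i.
    have tn : (t.+1 < n.+1)%N by apply: leq_ltn_trans (ltn_ord i).
    rewrite (bigD1 (Ordinal tn)) //= eqxx ti mulr1 big1 ?addr0 // => s.
    by rewrite -val_eqE /= => /negPf->; rewrite mul0r.
  rewrite big1 // => s _; case: eqP => [->|]; rewrite ?mul0r //.
  by rewrite ltnNge ti mulr0.
have [ti|ti] := ltnP t i.
  have iE : i.-1.+1 = i by case: (nat_of_ord i) ti.
  have pin : (i.-1 < n)%N by rewrite -ltnS iE ltn_ord.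
  rewrite (bigD1 (Ordinal pin)) //= iE eqxx (ltn_eqF pin).
  rewrite -ltnS iE ti mulr1 big1 ?addr0 // => s.
  rewrite -val_eqE /= => si; rewrite (ltn_eqF (ltn_ord s)).
  by rewrite -iE eqSS (negPf si) mulr0.
rewrite big1 // => s _; rewrite (ltn_eqF (ltn_ord s)).
case: eqP => [si|]; rewrite ?mulr0 // mulr1.
by move: ti; rewrite -si leqNgt ltnS => /negPf->.
Qed.

End CharPoly.

(** * Almost all singular values are equal to 1 *)

(** Sylvester's identity: both sides are the determinant of the block matrix
    with blocks [x, C, D, 1], up to a power of [x], by elimination of the lower
    left or of the lower right block. *)
Lemma det_scalar_sub_mulmx (A : comNzRingType) m n (x : A)
  (C : 'M[A]_(m, n)) (D : 'M[A]_(n, m)) :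
  x ^+ n * \det (x%:M - C *m D) = x ^+ m * \det (x%:M - D *m C).
Proof.
pose W := block_mx (x%:M : 'M[A]_m) C D (1%:M : 'M[A]_n).
have detW : \det W = \det (x%:M - C *m D).
  have := det_mulmx W (block_mx (1%:M : 'M[A]_m) 0 (- D) (1%:M : 'M[A]_n)).
  rewrite det_lblock !det1 !mulr1 => <-.
  rewrite mulmx_block !mulmx1 !mulmx0 !mul1mx mulmxN add0r subrr.
  by rewrite add0r det_ublock det1 mulr1.
have := det_mulmx (block_mx (1%:M : 'M[A]_m) 0 (- D) (x%:M : 'M[A]_n)) W.
rewrite detW det_lblock det1 mul1r det_scalar => <-.
rewrite mulmx_block !mulmx1 !mul1mx !mul0mx !addr0 mulNmx.
by rewrite -scalar_mxC addNr det_ublock det_scalar mulNmx addrC.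
Qed.

(** The geometric multiplicity bounds the algebraic one from below: a rank
    factorization [A - a = C D] through dimension [r] turns the characteristic
    polynomial into an [r] by [r] determinant times [(X - a)^(n - r)]. *)
Lemma dvdp_char_poly_rank (F : fieldType) n (A : 'M[F]_n) (a : F) :
  ('X - a%:P) ^+ (n - \rank (A - a%:M)) %| char_poly A.
Proof.
set r := \rank _; have rn : (r <= n)%N := rank_leq_row _.
have E : char_poly_mx A = ('X - a%:P)%:M -
    map_mx polyC (col_base (A - a%:M)) *m map_mx polyC (row_base (A - a%:M)).
  rewrite -map_mxM mulmx_base map_mxB map_scalar_mx /= /char_poly_mx.
  by rewrite raddfB /= opprB addrA subrK.
have := det_scalar_sub_mulmx ('X - a%:P)
  (map_mx polyC (col_base (A - a%:M))) (map_mx polyC (row_base (A - a%:M))).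
rewrite -E -/(char_poly A) -/r.
have -> : ('X - a%:P) ^+ n = ('X - a%:P) ^+ r * ('X - a%:P) ^+ (n - r).
  by rewrite -exprD subnKC.
rewrite -mulrA.
move/(mulfI _) => -> //; first by rewrite dvdp_mulr.
by rewrite expf_neq0 // polyXsubC_eq0.
Qed.

Lemma count_mem_prod_XsubC (F : fieldType) (s : seq F) (a : F) m :
  ('X - a%:P) ^+ m %| \prod_(z <- s) ('X - z%:P) -> (m <= count_mem a s)%N.
Proof.
elim: s m => [|z s IH] m.
  rewrite big_nil dvdp1; case: m => // m.
  by rewrite size_exp_XsubC.
rewrite big_cons /=; have [->|za] := eqVneq z a; last first.
  rewrite Gauss_dvdpr ?add0n; first exact: IH.
  by apply: coprimep_expl; rewrite coprimep_XsubC root_XsubC.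
case: m => // m; rewrite exprS dvdp_mul2l ?polyXsubC_eq0 //.
exact: IH.
Qed.

Section SingularValues.
Variable R : realType.

Lemma count_eigenvalues_rank n (A : 'M[R[i]]_n) (a : R[i]) :
  (n <= count_mem a (eigenvalues A) + \rank (A - a%:M)%R)%N.
Proof.
rewrite addnC -leq_subLR; apply: count_mem_prod_XsubC.
by rewrite -eigenvaluesP dvdp_char_poly_rank.
Qed.

Local Open Scope sesquilinear_scope.

(** Writing [B = S + u e^T], the product expands into [S^t* S - 1], which only
    has one nonzero entry, and two terms that each contain a vector. *)
Lemma rank_beta_gram n (beta : R[i]) :
  (\rank ((beta_mx n beta) ^t* *m beta_mx n beta - 1%:M)%R <= 3)%N.
Proof.
set S := shift_mx R n; set u := beta_vec n beta - first_vec R n.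
set B := beta_mx n beta.
have BE : B = S + u *m (ones_vec R n)^T by [].
have -> : B ^t* *m B - 1%:M =
    (S ^t* *m S - 1%:M) +
    (S ^t* *m (u *m (ones_vec R n)^T) + (u *m (ones_vec R n)^T)^t* *m B).
  have {1}-> : B ^t* = S ^t* + (u *m (ones_vec R n)^T)^t*.
    by rewrite BE linearD /= map_mxD.
  have SB : S ^t* *m B = S ^t* *m S + S ^t* *m (u *m (ones_vec R n)^T).
    by rewrite BE mulmxDr.
  rewrite mulmxDl SB -!addrA; congr (_ + _).
  by rewrite addrA [RHS]addrC.
apply: leq_trans (mxrank_add _ _) _; apply: (@leq_add _ _ 1 2); last first.
  apply: leq_trans (mxrank_add _ _) _; apply: (@leq_add _ _ 1 1).
    by rewrite mulmxA (leq_trans (mxrankM_maxr _ _)) // rank_leq_row.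
  rewrite trmx_mul map_mxM -mulmxA.
  by rewrite (leq_trans (mxrankM_maxr _ _)) // rank_leq_row.
have -> : S ^t* *m S - 1%:M = - (\col_i (i == n.-1 :> nat)%:R) *m
     (\row_j (j == n.-1 :> nat)%:R) :> 'M[R[i]]_n.
  apply/matrixP => i j; rewrite !mxE big_ord1 !mxE.
  under eq_bigr => s _ do rewrite !mxE rmorph_nat -natrM mulnb.
  have [<-|ij] := eqVneq i j; last first.
    rewrite big1 ?sub0r; last first.
      move=> s _; case: eqP => //= si; case: eqP => //= sj.
      by case/eqP: ij; apply: val_inj => /=; lia.
    have [iN|] := eqVneq (i : nat) n.-1; last by rewrite /= ?(oppr0, mul0r).
    have [jN|] := eqVneq (j : nat) n.-1; last by rewrite /= ?(mulr0, oppr0).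
    by case/eqP: ij; apply: val_inj; rewrite /= iN jN.
  have [iN|iN] := eqVneq (i : nat) n.-1.
    rewrite big1 /= ?sub0r ?mulN1r ?mulr1 //.
    move=> s _; case: eqP => //= si.
    by have := ltn_ord s; have := ltn_ord i; lia.
  have i1 : (i.+1 < n)%N by have := ltn_ord i; lia.
  rewrite (bigD1 (Ordinal i1)) //= eqxx big1 ?addr0 ?subrr ?oppr0 ?mul0r //.
  by move=> s; rewrite -val_eqE /= => /negPf->.
apply: leq_trans (mxrankM_maxr _ _) _; exact: rank_leq_row.
Qed.
End SingularValues.

(** * Landau's inequality *)
Section Landau.
Variable R : rcfType.
Implicit Types (p : {poly R[i]}) (s : seq R[i]).

(** The squared 2-norm of the coefficients, truncated below degree [N] so that
    polynomials of different sizes are summed over the same range. *)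
Definition sqnorm N p : R := \sum_(i < N) normc p`_i ^+ 2.

(** Reflecting a zero in the unit circle preserves the 2-norm: coefficientwise
    the two squares differ by [(1 - |z|^2) (|p_(i-1)|^2 - |p_i|^2)], a
    telescoping sum. *)
Lemma sqnorm_reflect N p (z : R[i]) : (size p <= N)%N ->
  sqnorm N.+1 (('X - z%:P) * p) = sqnorm N.+1 ((1 - (z^*)%C *: 'X) * p).
Proof.
move=> sp; apply/eqP; rewrite -subr_eq0 /sqnorm -sumrB.
pose d i : R := (1 - normc z ^+ 2) * (if i is j.+1 then normc p`_j ^+ 2 else 0).
rewrite (eq_bigr (fun i : 'I_N.+1 => d i - d i.+1)); last first.
  move=> i _; rewrite !mulrBl coefB coefXM coefCM mul1r coefB -scalerAl coefZ coefXM.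
  rewrite /d; case: (i : nat) => [|j] /=.
    rewrite mulr0 subr0 sub0r normc_opp normcM; ring.
  rewrite !normc_sqr; case: (z) (p`_j) (p`_j.+1) => [z1 z2] [a1 a2] [b1 b2].
  rewrite /=; ring.
rewrite -(big_mkord xpredT (fun i => d i - d i.+1)).
under eq_bigr do rewrite -opprB.
rewrite sumrN telescope_sumr //.
by rewrite /d mulr0 nth_default // normc0 expr0n mulr0 subrr oppr0.
Qed.

(** The reflection is applied exactly to the zeros outside the disc, so that
    the leading coefficient of the product is, up to phase, the product of
    their moduli. *)
Definition landau_factor (z : R[i]) : {poly R[i]} :=
  if normc z <= 1 then 'X - z%:P else 1 - (z^*)%C *: 'X.

Lemma size_landau_factor z : (size (landau_factor z) <= 2)%N.
Proof.
rewrite /landau_factor; case: ifP => _; first by rewrite size_XsubC.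
rewrite (leq_trans (size_polyD _ _)) // geq_max size_poly1 size_polyN.
by rewrite (leq_trans (size_scale_leq _ _)) ?size_polyX.
Qed.

Lemma sqnorm_landau s p N : (size p + size s <= N.+1)%N ->
  sqnorm N.+1 (p * \prod_(z <- s) ('X - z%:P)) =
  sqnorm N.+1 (p * \prod_(z <- s) landau_factor z).
Proof.
elim: s p => [|z s IH] p /= sN; first by rewrite !big_nil.
have sP : (size (p * \prod_(z0 <- s) ('X - z0%:P))%R <= N)%N.
  rewrite (leq_trans (size_polyMleq _ _)) // size_prod_XsubC.
  by move: sN; rewrite !addnS ltnS.
transitivity (sqnorm N.+1
    (landau_factor z * (p * \prod_(z0 <- s) ('X - z0%:P)))).
  rewrite /landau_factor; case: ifP => _; first by rewrite big_cons mulrCA.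
  by rewrite -sqnorm_reflect // big_cons mulrCA.
rewrite mulrA IH ?big_cons; first by rewrite [_ * p]mulrC mulrA.
rewrite (leq_trans _ sN) // addnS -addSn leq_add2r.
rewrite (leq_trans (size_polyMleq _ _)) //.
by have := leq_add (size_landau_factor z) (leqnn (size p)); case: (_ + size p)%N.
Qed.

Lemma coef_prod_deg1 (A : comNzRingType) (T : Type) (s : seq T)
    (f : T -> {poly A}) : (forall z, (size (f z) <= 2)%N) ->
  (\prod_(z <- s) f z)`_(size s) = \prod_(z <- s) (f z)`_1
  /\ (size (\prod_(z <- s) f z)%R <= (size s).+1)%N.
Proof.
move=> sf; elim: s => [|z s [IH1 IH2]]; first by rewrite !big_nil coef1 size_poly1.
rewrite !big_cons; split; last first.
  rewrite (leq_trans (size_polyMleq _ _)) //=.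
  by have := leq_add (sf z) IH2; case: (_ + size _)%N.
rewrite coefM /= -IH1 !big_ord_recl [X in _ + (_ + X)]big1 ?addr0.
  rewrite /= subn0 [X in _ * X + _]nth_default // mulr0 add0r.
  by rewrite /bump /= addn0 subSS subn0.
move=> i _; rewrite /= /bump /= [X in X * _]nth_default ?mul0r //.
by rewrite (leq_trans (sf z)).
Qed.

(** After the reflections the right-hand side is the norm of a polynomial whose
    leading coefficient has the left-hand side as square modulus. *)
Theorem landau s :
  \prod_(z <- s) Num.max 1 (normc z) ^+ 2 <=
  sqnorm (size s).+1 (\prod_(z <- s) ('X - z%:P)).
Proof.
have := @sqnorm_landau s 1 (size s); rewrite !mul1r size_poly1 => -> //.
rewrite /sqnorm big_ord_recr /= (coef_prod_deg1 _ size_landau_factor).1.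
rewrite normc_prod -prodrXl.
rewrite [X in X <= _](eq_bigr (fun z => normc (landau_factor z)`_1 ^+ 2)).
  by rewrite lerDr sumr_ge0 // => i _; rewrite sqr_ge0.
move=> z _; rewrite /landau_factor; congr (_ ^+ 2).
case: leP => z1; rewrite coefB.
  by rewrite coefX coefC subr0 normc1.
by rewrite coef1 coefZ coefX mulr1 sub0r normc_opp normc_conj.
Qed.

End Landau.

(** * Newton's identities for reciprocal zeros *)
Section Newton.
Variable F : fieldType.

Definition newton_sum (s : seq F) (k : nat) : F := \sum_(w <- s) w ^+ k.

(** The logarithmic derivative of [E] is minus the generating series of the
    power sums; truncating the series leaves a multiple of [X^K]. *)
Lemma newton_deriv (s : seq F) K : exists S : {poly F},
  let E := \prod_(w <- s) (1 - w *: 'X) in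
  E^`() + E * \poly_(k < K) newton_sum s k.+1 = 'X^K * S.
Proof.
elim: s => [|w s [S IH]] /=.
  exists 0; rewrite big_nil -polyC1 derivC mulr0 add0r mul1r.
  by apply/polyP => i; rewrite coef_poly coef0 /newton_sum big_nil if_same.
rewrite /= in IH; set E := \prod_(z <- s) _ in IH.
exists ((1 - w *: 'X) * S - (w ^+ K.+1) *: E).
rewrite big_cons -/E derivM derivB derivZ derivX -polyC1 derivC sub0r polyC1.
have -> : \poly_(k < K) newton_sum (w :: s) k.+1 =
    \poly_(k < K) newton_sum s k.+1 + w *: \poly_(k < K) w ^+ k.
  apply/polyP => i; rewrite coefD coefZ !coef_poly /newton_sum big_cons.
  by case: ifP; rewrite ?mulr0 ?addr0 // exprS addrC.
have G : (1 - w *: 'X) * \poly_(k < K) w ^+ k = 1 - (w ^+ K) *: 'X^K.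
  rewrite -exprZn; have := subrXX_comm K (mulrC 1 (w *: 'X : {poly F})).
  rewrite expr1n => ->; congr (_ * _).
  rewrite poly_def; apply: eq_bigr => i _.
  by rewrite expr1n mul1r exprZn.
move: IH G; set P := \poly_(k < K) newton_sum _ _.
set Q := \poly_(k < K) _ => IH G.
have -> : - (w *: (1 : {poly F})) * E + (1 - w *: 'X) * E^`()
          + (1 - w *: 'X) * E * (P + w *: Q)
   = (1 - w *: 'X) * (E^`() + E * P) + w *: ((1 - w *: 'X) * Q * E) - w *: E.
  rewrite -!mul_polyC; ring.
rewrite IH G exprS -!mul_polyC rmorphM; ring.
Qed.

Lemma newton_identity (s : seq F) k (E := \prod_(w <- s) (1 - w *: 'X)) :
  newton_sum s k.+1 =
  - (E`_k.+1 *+ k.+1) - \sum_(j < k) E`_j.+1 * newton_sum s (k - j).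
Proof.
have [S /= HS] := newton_deriv s k.+1.
have := congr1 (fun p : {poly F} => p`_k) HS.
rewrite coefXnM ltnSn coefD coef_deriv coefM big_ord_recl /= -/E.
rewrite coef_poly subn0 ltnSn.
have -> : E`_0 = 1.
  rewrite /E -horner_coef0 horner_prod big1 // => w _.
  by rewrite !hornerE ?mulr0 ?subr0.
rewrite mul1r => /eqP; rewrite addrCA addr_eq0 => /eqP ->.
rewrite opprD; congr (_ - _); apply: eq_bigr => j _.
rewrite /bump /= coef_poly ltnS leq_subr; congr (_ * newton_sum s _).
by have := ltn_ord j; lia.
Qed.

End Newton.

(** * Zeros of polynomials with moderate coefficients *)
Section Zeros.
Variable R : realType.

(** The bound depends on [B] and [k] only, not on the number of terms: this is
    what makes the power sums negligible compared to the degree. *)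
Lemma newton_sum_bound (B : R) k : 0 <= B -> exists D : R, forall s : seq R[i],
  (forall j, normc (\prod_(w <- s) (1 - w *: 'X))`_j <= B * j.+1%:R) ->
  forall i, (i < k)%N -> normc (newton_sum s i.+1) <= D.
Proof.
move=> B0; elim: k => [|k [D IH]]; first by exists 0.
pose D' := B * k.+2%:R * k.+1%:R + \sum_(j < k) B * j.+2%:R * `|D|.
have D'0 : 0 <= D'.
  by rewrite addr_ge0 ?mulr_ge0 // sumr_ge0 // => j _; rewrite !mulr_ge0.
exists (`|D| + D') => s sB i; rewrite ltnS leq_eqVlt => /orP[/eqP->|ik]; last first.
  by rewrite (le_trans (IH _ sB _ ik)) // (le_trans (ler_norm _)) // lerDl.
rewrite newton_identity (le_trans (normcD _ _)) // !normc_opp.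
rewrite (le_trans _ (_ : D' <= _)) ?lerDr // lerD //.
  by rewrite -[X in normc X]mulr_natr normcM normc_nat ler_wpM2r.
apply: le_trans (normc_sum _ _ _) _; apply: ler_sum => j _.
rewrite normcM ler_pM ?normc_ge0 //.
have -> : (k - j = (k - j.+1).+1)%N by have := ltn_ord j; lia.
by apply: le_trans (ler_norm D); apply: IH => //; have := ltn_ord j; lia.
Qed.

Lemma geom_sum_le2 (x : R) m : 0 <= x <= 2^-1 -> \sum_(i < m) x ^+ i <= 2.
Proof.
move=> /andP[x0 x1]; suff: (1 - x) * \sum_(i < m) x ^+ i <= 1.
  have : 0 <= \sum_(i < m) x ^+ i by apply: sumr_ge0 => i _; rewrite exprn_ge0.
  by nra.
have := subrXX_comm m (mulrC 1 x); rewrite expr1n.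
under eq_bigr do rewrite expr1n mul1r.
by move=> <-; rewrite gerBl exprn_ge0.
Qed.

(** Near the origin the constant term dominates: for [|z| < 1/4] the other terms
    sum to at most [4 A |z|], as [i + 1 <= 2^i]. *)
Lemma root_normc_ge (q : {poly R[i]}) (A a : R) (z : R[i]) :
  0 < a <= A -> (forall i, normc q`_i <= A * i.+1%:R) -> a <= normc q`_0 ->
  root q z -> a / (4 * A) <= normc z.
Proof.
move=> /andP[a0 aA] qA aq /rootP; rewrite horner_coef.
have A0 : 0 < A by apply: lt_le_trans aA.
case: (size q) (nth_default 0 (leqnn (size q))) => [|m _].
  by move=> q0; move: aq; rewrite q0 normc0 leNgt a0.
rewrite big_ord_recl mulr1 => /eqP; rewrite addr_eq0 => /eqP q0.
rewrite leNgt; apply/negP; rewrite ltr_pdivlMr ?mulr_gt0 // => zs.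
set t := normc z in zs; have t0 : 0 <= t by apply: normc_ge0.
have t4 : t < 4^-1 by rewrite -[ltRHS]mul1r ltr_pdivlMr // ; nra.
suff : normc q`_0 <= A * (t * 4) by lra.
rewrite q0 normc_opp (le_trans (normc_sum _ _ _)) //.
apply: (@le_trans _ _ (\sum_(i < m) A * (2 * t) * (2 * t) ^+ i)).
  apply: ler_sum => i _; rewrite normcM normcX -/t /= /bump /= add1n.
  rewrite -mulrA -exprS exprMn mulrA ler_wpM2r ?exprn_ge0 //.
  rewrite (le_trans (qA _)) // ler_wpM2l ?(ltW A0) //.
  by rewrite -natrX ler_nat ltn_expl.
rewrite -mulr_sumr (le_trans (ler_wpM2l _ (geom_sum_le2 m _))) //; try lra.
  by rewrite !mulr_ge0 // ltW.
Qed.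

Lemma abs_ln_max (t : R) : 0 < t ->
  `|ln t| = ln (Num.max 1 t ^+ 2) - ln t.
Proof.
move=> t0; have [t1|t1] := leP t 1.
  by rewrite expr1n ln1 sub0r ler0_norm // ln_le0.
rewrite ger0_norm ?ln_ge0 ?(ltW t1) // lnXn // mulr2n; ring.
Qed.

(** Landau's inequality controls the positive parts of [ln |z|], and the sum of
    all the [ln |z|] is [ln |q_0|]. *)
Lemma sum_abs_ln_roots (s : seq R[i]) (A a : R)
    (q := \prod_(z <- s) ('X - z%:P)) :
  0 < a <= A -> (forall i, normc q`_i <= A * i.+1%:R) -> a <= normc q`_0 ->
  \sum_(z <- s) `|ln (normc z)| <=
    ln (A ^+ 2) - ln a + 3 * ln (size s).+1%:R.
Proof.
move=> /andP[a0 aA] qA aq.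
have A0 : 0 < A by apply: lt_le_trans aA.
have q0 : q`_0 = \prod_(z <- s) - z.
  by rewrite -horner_coef0 horner_prod; under eq_bigr do rewrite !hornerE.
have sn0 z : z \in s -> 0 < normc z.
  move=> zs; rewrite normc_gt0; apply: contraTneq aq => z0.
  rewrite q0 (big_rem _ zs) /= z0 oppr0 mul0r normc0 -ltNge //.
have lnprod (f : R[i] -> R) : (forall z, z \in s -> 0 < f z) ->
    \sum_(z <- s) ln (f z) = ln (\prod_(z <- s) f z).
  elim: (s) => [|z r IH] H; first by rewrite !big_nil ln1.
  rewrite !big_cons lnM ?IH //.
  - by move=> y yr; rewrite H // inE yr orbT.
  - by rewrite posrE H // inE eqxx.
  - rewrite posrE big_seq prodr_gt0 // => y yr.
    by rewrite H // inE yr orbT.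
rewrite (eq_big_seq (fun z => ln (Num.max 1 (normc z) ^+ 2) - ln (normc z))); last first.
  by move=> z zs; rewrite abs_ln_max // sn0.
rewrite sumrB !lnprod //; last first.
  by move=> z zs; rewrite exprn_gt0 // lt_max ltr01.
have -> : \prod_(z <- s) normc z = normc q`_0.
  by rewrite q0 normc_prod; apply: eq_bigr => z _; rewrite normc_opp.
rewrite addrAC lerB ?ler_ln ?posrE ?(lt_le_trans a0) //.
set m := (size s).+1.
have -> : 3 * ln m%:R = ln (m%:R ^+ 3 : R) by rewrite lnXn ?ltr0n // mulr_natl.
rewrite -lnM ?posrE ?exprn_gt0 ?ltr0n //.
rewrite ler_ln ?posrE ?mulr_gt0 ?exprn_gt0 ?ltr0n //; last first.
  by rewrite prodr_gt0 // => z _; rewrite exprn_gt0 // lt_max ltr01.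
apply: le_trans (landau s) _; rewrite /sqnorm -/q -/m.
apply: (@le_trans _ _ (\sum_(i < m) (A * m%:R) ^+ 2)).
  apply: ler_sum => i _; rewrite lerXn2r ?nnegrE ?normc_ge0 ?mulr_ge0 ?(ltW A0) //.
  by rewrite (le_trans (qA i)) // ler_wpM2l ?(ltW A0) // ler_nat.
rewrite sumr_const card_ord -mulr_natr exprMn le_eqVlt; apply/orP; left; apply/eqP; ring.
Qed.

Lemma abs_1subX_le (t r : R) k : 0 < t <= r -> 1 <= r ->
  `|1 - t ^+ k| <= k%:R * r ^+ k * `|ln t|.
Proof.
move=> /andP[t0 tr] r1.
have lnle (y : R) : 0 < y -> ln y <= y - 1.
  move=> y0; have := @le_ln1Dx _ (y - 1).
  by rewrite (_ : 1 + (y - 1) = y); [apply; lra | ring].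
have tk : 0 < t ^+ k by rewrite exprn_gt0.
have rk : 1 <= r ^+ k by rewrite exprn_ege1.
have [t1|t1] := leP 1 t.
  rewrite distrC ger0_norm ?subr_ge0 ?exprn_ege1 // ger0_norm ?ln_ge0 //.
  have := lnle (t ^+ k)^-1; rewrite invr_gt0 lnV ?posrE // lnXn //.
  move=> /(_ tk); rewrite -(ler_pM2r tk) mulrBl mulVf ?gt_eqF // mul1r -mulr_natl.
  have : t ^+ k <= r ^+ k by rewrite lerXn2r ?nnegrE //; lra.
  have : 0 <= k%:R * ln t by rewrite mulr_ge0 ?ln_ge0.
  nra.
have t1' : t <= 1 by lra.
rewrite ger0_norm ?subr_ge0 ?exprn_ile1 ?(ltW t0) // ler0_norm ?ln_le0 //.
have := lnle _ tk; rewrite lnXn // -mulr_natl.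
have : 0 <= k%:R * - ln t by rewrite mulr_ge0 // oppr_ge0 ln_le0.
nra.
Qed.

(** The radial projection onto the unit circle; the value 1 at the origin makes
    it a point of the circle in all cases. *)
Definition unitc (z : R[i]) : R[i] := if z == 0 then 1 else z / (normc z)%:C.

Lemma normc_unitc z : normc (unitc z) = 1.
Proof.
rewrite /unitc; case: eqVneq => [_|z0]; first by rewrite normc1.
rewrite normcM normcV normc_real ger0_norm ?normc_ge0 // divff //.
by rewrite normc_eq0.
Qed.

Lemma unitcE z : z = unitc z * (normc z)%:C.
Proof.
rewrite /unitc; case: eqVneq => [->|z0]; first by rewrite normc0 mulr0.
by rewrite divfK // eq_complex /= eqxx andbT normc_eq0.
Qed.

Lemma unitc_mulJ z : unitc z * (unitc z)^*%C = 1.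
Proof. by rewrite mulcJ normc_unitc expr1n. Qed.

(** The reciprocals [z^-1] lie in a fixed disc by [root_normc_ge], so that their
    [k]-th powers differ from those of the conjugates of [unitc z] by at most a
    constant times [|ln |z||]; their power sums are bounded by Newton's
    identities applied to [q / q_0 = \prod (1 - z^-1 X)]. *)
Lemma unitc_moment_bound (A a : R) : 0 < a <= A -> forall k, exists C : R,
  forall s : seq R[i], let q := \prod_(z <- s) ('X - z%:P) in
  (forall i, normc q`_i <= A * i.+1%:R) -> a <= normc q`_0 ->
  normc (\sum_(z <- s) unitc z ^+ k.+1) <= C + C * ln (size s).+1%:R.
Proof.
move=> /andP[a0 aA] k; have A0 : 0 < A by apply: lt_le_trans aA.
have [|D HD] := @newton_sum_bound (A / a) k.+1; first by rewrite divr_ge0 ?ltW.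
pose r := 4 * A / a.
have r1 : 1 <= r by rewrite /r ler_pdivlMr //; lra.
pose c := k.+1%:R * r ^+ k.+1.
have c0 : 0 <= c by rewrite mulr_ge0 // exprn_ge0 // (le_trans _ r1).
pose C := Num.max (D + c * (ln (A ^+ 2) - ln a)) (c * 3).
exists C => s q qA aq.
have q0 : q`_0 = \prod_(z <- s) - z.
  by rewrite -horner_coef0 horner_prod; under eq_bigr do rewrite !hornerE.
have sn0 z : z \in s -> z != 0.
  move=> zs; apply: contraTneq aq => z0.
  by rewrite q0 (big_rem _ zs) /= z0 oppr0 mul0r normc0 -ltNge.
have q0n0 : q`_0 != 0 by rewrite -normc_gt0 (lt_le_trans a0).
have nw z : z \in s -> 0 < normc z^-1 <= r.
  move=> zs; have zq : root q z by rewrite root_prod_XsubC.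
  rewrite normcV invr_gt0 normc_gt0 sn0 //=.
  have := @root_normc_ge q A a z; rewrite a0 aA => /(_ isT qA aq zq) H.
  rewrite -[r]invrK lef_pV2 ?posrE ?normc_gt0 ?sn0 //.
    by rewrite /r invf_div.
  by rewrite invr_gt0 (lt_le_trans ltr01).
have E : \prod_(w <- [seq z^-1 | z <- s]) (1 - w *: 'X) = (q`_0)^-1 *: q.
  rewrite big_map q0 /q -mul_polyC -prodfV rmorph_prod -big_split /=.
  apply: eq_big_seq => z zs; rewrite mulrBr -polyCM.
  have zn0 := sn0 _ zs; rewrite invrN mulNr mulVf // polyCN polyCN opprK polyC1.
  by rewrite mulNr mul_polyC addrC.
have pk : normc (newton_sum [seq z^-1 | z <- s] k.+1) <= D.
  apply: HD => // j; rewrite E coefZ normcM normcV mulrC [leRHS]mulrAC.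
  rewrite ler_pM ?invr_ge0 ?normc_ge0 //.
  by rewrite lef_pV2 ?posrE ?normc_gt0.
have dist : normc (\sum_(z <- s) (unitc z)^*%C ^+ k.+1 -
     newton_sum [seq z^-1 | z <- s] k.+1) <= c * \sum_(z <- s) `|ln (normc z)|.
  rewrite /newton_sum big_map -sumrB mulr_sumr.
  apply: le_trans (normc_sum _ _ _) _; rewrite big_seq [leRHS]big_seq.
  apply: ler_sum => z zs; have zn0 := sn0 _ zs; have nz0 : normc z != 0 by rewrite normc_eq0.
  have -> : z^-1 = (unitc z)^*%C * (normc z^-1)%:C.
    apply: (mulfI zn0); rewrite divff // {1}(unitcE z) mulrACA unitc_mulJ mul1r.
    by rewrite -rmorphM normcV divff.
  rewrite exprMn -[X in X - _]mulr1 -mulrBr normcM normcX normc_conj normc_unitc expr1n mul1r.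
  rewrite -rmorphXn -(rmorph1 (real_complex R)) -rmorphB normc_real.
  rewrite (le_trans (abs_1subX_le _ (nw _ zs) r1)) //.
  by rewrite normcV lnV ?posrE ?normc_gt0 // normrN.
have -> : normc (\sum_(z <- s) unitc z ^+ k.+1) =
          normc (\sum_(z <- s) (unitc z)^*%C ^+ k.+1).
  rewrite -normc_conj rmorph_sum; congr normc; apply: eq_bigr => z _.
  by rewrite rmorphXn.
have L := sum_abs_ln_roots (introT andP (conj a0 aA)) qA aq.
have ln0 : 0 <= ln (size s).+1%:R :> R by rewrite ln_ge0 // ler1n.
apply: (@le_trans _ _ (D + c * \sum_(z <- s) `|ln (normc z)|)).
  rewrite -[X in normc X](subrK (newton_sum [seq z^-1 | z <- s] k.+1)).
  by rewrite (le_trans (normcD _ _)) // addrC lerD.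
apply: (@le_trans _ _ (D + c * (ln (A ^+ 2) - ln a + 3 * ln (size s).+1%:R))).
  by rewrite lerD2l ler_wpM2l.
rewrite mulrDr addrA mulrA lerD ?ler_wpM2r // /C le_max lexx ?orbT //.
Qed.

End Zeros.

(** * Comparing point families on the circle by their moments *)
Section Discrepancy.
Variable R : realType.
Implicit Types (us ws : seq R[i]) (u w v : R[i]).

Definition small_moments (N : nat) (eta : R) us :=
  [/\ (0 < size us)%N, {in us, forall u, normc u = 1} &
    forall k, (0 < k <= N)%N ->
      normc (\sum_(u <- us) u ^+ k) <= eta * (size us)%:R].

(** On the circle this is [|1 + u / w|^(2 N)], a trigonometric polynomial of
    degree [N] in [u] with constant coefficient ['C(2 N, N)]; it is maximal
    at [u = w]. *)
Definition kernel (N : nat) u w : R := normc (1 + u * w^*%C) ^+ 2 ^+ N.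

Lemma kernel_ge0 N u w : 0 <= kernel N u w.
Proof. by rewrite !exprn_ge0 // normc_ge0. Qed.

Lemma normc1_mulJ v : normc v = 1 -> v * v^*%C = 1.
Proof. by move=> v1; rewrite mulcJ v1 expr1n. Qed.

Lemma kernelC N u w : normc u = 1 -> normc w = 1 -> kernel N u w = kernel N w u.
Proof.
move=> u1 w1; rewrite /kernel -[in LHS]normc_conj; congr (normc _ ^+ 2 ^+ N).
by rewrite rmorphD rmorph1 rmorphM /= conjcK mulrC.
Qed.

(** With [v = u / w] of modulus 1, [|1 + v|^2 = (1 + v)^2 / v], and the binomial
    formula applies. *)
Lemma kernelE N u w : normc u = 1 -> normc w = 1 ->
  (kernel N u w)%:C =
  \sum_(k < (2 * N).+1) ((u ^+ k * u^*%C ^+ N) * (w ^+ N * w^*%C ^+ k))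
     *+ 'C(2 * N, k).
Proof.
move=> u1 w1; rewrite /kernel rmorphXn /= -mulcJ; set v := u * w^*%C.
have v1 : v * v^*%C = 1 by rewrite mulcJ /v normcM normc_conj u1 w1 mulr1 expr1n.
have -> : (1 + v) * (1 + v)^*%C = (1 + v) ^+ 2 * v^*%C.
  rewrite rmorphD rmorph1 expr2 -mulrA; congr (_ * _).
  by rewrite mulrDl v1 mul1r addrC.
rewrite exprMn -exprM exprDn mulr_suml; apply: eq_bigr => k _.
rewrite expr1n mul1r mulrnAl; congr (_ *+ _).
rewrite /v rmorphM /= conjcK !exprMn; ring.
Qed.

Lemma sum_binomials n : (\sum_(k < n.+1) 'C(n, k))%N = (2 ^ n)%N.
Proof.
rewrite -[2%N]/(1 + 1)%N expnDn; apply: eq_bigr => k _.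
by rewrite !exp1n !muln1.
Qed.

Lemma mixed_moment N eta us a b : small_moments N eta us ->
  a != b -> (a <= b + N)%N -> (b <= a + N)%N ->
  normc (\sum_(u <- us) u ^+ a * u^*%C ^+ b) <= eta * (size us)%:R.
Proof.
move=> [_ us1 mom]; wlog ab : a b / (b < a)%N.
  move=> H ab aN bN; case: (ltngtP a b) (ab) => // lab _; last exact: H.
  rewrite -normc_conj rmorph_sum /=.
  under eq_bigr => u _ do rewrite rmorphM !rmorphXn /= conjcK mulrC.
  by apply: H => //; rewrite eq_sym.
move=> _ aN _; rewrite (eq_big_seq (fun u => u ^+ (a - b))); last first.
  move=> u /us1 u1; rewrite -{1}(subnK (ltnW ab)) exprD -mulrA -exprMn.
  by rewrite normc1_mulJ // expr1n mulr1.
by apply: mom; lia.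
Qed.

(** In the expansion [kernelE] only the term [k = N] is free of [u]; all others
    are moments of order between 1 and [N], and their binomial weights sum to
    at most [4^N]. *)
Lemma kernel_sum N eta us w : 0 <= eta -> small_moments N eta us ->
  normc w = 1 ->
  `|\sum_(u <- us) kernel N u w - 'C(2 * N, N)%:R * (size us)%:R| <=
  eta * 4 ^+ N * (size us)%:R.
Proof.
move=> eta0 mus w1; have [us0 us1 mom] := mus.
rewrite -normc_real rmorphB rmorph_sum /=.
rewrite (eq_big_seq _ (fun u us_u => kernelE N (us1 u us_u) w1)) exchange_big /=.
have Nlt : (N < (2 * N).+1)%N by lia.
rewrite (bigD1 (Ordinal Nlt)) //=.
have -> : \sum_(u <- us) u ^+ N * u^*%C ^+ N * (w ^+ N * w^*%C ^+ N)
     *+ 'C(2 * N, N) = ('C(2 * N, N)%:R * (size us)%:R)%:C.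
  rewrite (eq_big_seq (fun=> 1 *+ 'C(2 * N, N))); last first.
    move=> u /us1 u1; by rewrite -!exprMn !normc1_mulJ // mulr1 expr1n.
  by rewrite big_const_seq count_predT iter_addr_0 -mulrnA -natrM rmorph_nat.
rewrite addrAC subrr add0r.
apply: le_trans (normc_sum _ _ _) _.
apply: (@le_trans _ _ (\sum_(k < (2 * N).+1)
    eta * (size us)%:R * ('C(2 * N, k)%:R : R))).
  rewrite [leRHS](bigD1 (Ordinal Nlt)) //= ler_wpDl ?mulr_ge0 //.
  apply: ler_sum => k; rewrite -val_eqE /= => kN.
  under eq_bigr => u _ do rewrite -mulrnAr.
  rewrite -mulr_suml -mulr_natr !normcM normc_nat !normcX normc_conj w1.
  rewrite !expr1n mulr1 mul1r ler_wpM2r //.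
  by apply: mixed_moment mus _ _ _ => //; have := ltn_ord k; lia.
rewrite -mulr_sumr -natr_sum sum_binomials expnM natrX mulrAC //.
Qed.

Lemma ler_norm_sum_size (T : eqType) (s : seq T) (F : T -> R) (c : R) :
  {in s, forall x, `|F x| <= c} -> `|\sum_(x <- s) F x| <= (size s)%:R * c.
Proof.
move=> Fc; apply: le_trans (ler_norm_sum _ _ _) _.
rewrite big_seq (le_trans (ler_sum _ Fc)) // -big_seq.
by rewrite big_const_seq count_predT iter_addr_0 mulr_natl.
Qed.

(** Both means are compared with the double mean of [f] weighted by the kernel.
    The sums of the kernel in either variable are nearly constant, and
    [f u - f w] is small unless [u] and [w] are at distance at least [d], where
    the kernel is at most [(4 - d^2)^N] by the parallelogram identity. *)
Lemma mean_discrepancy N eta us ws (f : R[i] -> R) (A e d : R) :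
  0 <= eta -> small_moments N eta us -> small_moments N eta ws ->
  0 <= A -> 0 <= e -> 0 < d <= 1 ->
  (forall u, normc u = 1 -> `|f u| <= A) ->
  (forall u w, normc u = 1 -> normc w = 1 ->
     normc (u - w) < d -> `|f u - f w| <= e) ->
  'C(2 * N, N)%:R *
  `|(size us)%:R^-1 * \sum_(u <- us) f u -
    (size ws)%:R^-1 * \sum_(w <- ws) f w| <=
  'C(2 * N, N)%:R * e + eta * 4 ^+ N * (2 * A + e) + 2 * A * (4 - d ^+ 2) ^+ N.
Proof.
move=> eta0 mus mws A0 e0 /andP[d0 d1] fA fe.
have [us0 us1 _] := mus; have [ws0 ws1 _] := mws.
set n : R := (size us)%:R; set m : R := (size ws)%:R; set kap : R := _%:R.
have n0 : 0 < n by rewrite ltr0n.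
have m0 : 0 < m by rewrite ltr0n.
set h := eta * 4 ^+ N.
have h0 : 0 <= h by rewrite mulr_ge0 // exprn_ge0.
have d40 : 0 <= (4 - d ^+ 2) ^+ N by rewrite exprn_ge0 //; nra.
have Ku w : normc w = 1 ->
    `|\sum_(u <- us) kernel N u w - kap * n| <= h * n by exact: kernel_sum.
have Kw u : normc u = 1 ->
    `|\sum_(w <- ws) kernel N u w - kap * m| <= h * m.
  move=> u1; rewrite (eq_big_seq (fun w => kernel N w u)).
    exact: kernel_sum.
  by move=> w /ws1 w1; rewrite kernelC.
have far u w : normc u = 1 -> normc w = 1 ->
    kernel N u w * `|f u - f w| <= e * kernel N u w + 2 * A * (4 - d ^+ 2) ^+ N.
  move=> u1 w1; have [ud|ud] := ltP (normc (u - w)) d.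
    rewrite ler_wpDr ?mulr_ge0 // [leRHS]mulrC.
    by rewrite ler_wpM2l ?kernel_ge0 // fe.
  rewrite ler_wpDl ?mulr_ge0 ?kernel_ge0 // mulrC.
  have fuw : `|f u - f w| <= 2 * A.
    by rewrite (le_trans (ler_normB _ _)) // mulr2n mulrDl mul1r lerD // fA.
  rewrite ler_pM // ?kernel_ge0 // /kernel.
  rewrite lerXn2r ?nnegrE ?exprn_ge0 ?normc_ge0 //; first nra.
  have -> : normc (1 + u * w^*%C) ^+ 2 = 4 - normc (u - w) ^+ 2.
    have U : normc u ^+ 2 = 1 by rewrite u1 expr1n.
    have W : normc w ^+ 2 = 1 by rewrite w1 expr1n.
    move: U W; rewrite !normc_sqr; case: (u) (w) => [a b] [c g] /= U W.
    have -> : 4 - ((a - c) ^+ 2 + (b - g) ^+ 2) =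
       4 - (a ^+ 2 + b ^+ 2) - (c ^+ 2 + g ^+ 2) + 2 * (a * c + b * g) by ring.
    have -> : (1 + (a * c - b * - g)) ^+ 2 + (0 + (a * - g + b * c)) ^+ 2 =
       1 + 2 * (a * c + b * g) + (a ^+ 2 + b ^+ 2) * (c ^+ 2 + g ^+ 2) by ring.
    rewrite U W; ring.
  rewrite lerD2l lerN2 lerXn2r ?nnegrE ?normc_ge0 // ltW //.
pose S1 := \sum_(u <- us) f u * (kap * m - \sum_(w <- ws) kernel N u w).
pose S2 := \sum_(u <- us) \sum_(w <- ws) kernel N u w * (f u - f w).
pose S3 := \sum_(w <- ws) f w * (\sum_(u <- us) kernel N u w - kap * n).
have split_ : kap * (n^-1 * \sum_(u <- us) f u - m^-1 * \sum_(w <- ws) f w) =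
   (n * m)^-1 * (S1 + S2 + S3).
  have -> : S2 = \sum_(u <- us) f u * (\sum_(w <- ws) kernel N u w) -
                 \sum_(w <- ws) f w * (\sum_(u <- us) kernel N u w).
    under [X in _ = _ - X]eq_bigr do rewrite mulr_sumr.
    rewrite [X in _ = _ - X]exchange_big -sumrB; apply: eq_bigr => u _ /=.
    rewrite mulr_sumr -sumrB; apply: eq_bigr => w _.
    by rewrite mulrBr ![kernel _ _ _ * _]mulrC.
  have -> : S1 = (\sum_(u <- us) f u) * (kap * m) -
                 \sum_(u <- us) f u * (\sum_(w <- ws) kernel N u w).
    by rewrite mulr_suml -sumrB; apply: eq_bigr => u _; rewrite mulrBr.
  have -> : S3 = \sum_(w <- ws) f w * (\sum_(u <- us) kernel N u w) -
                 (\sum_(w <- ws) f w) * (kap * n).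
    by rewrite mulr_suml -sumrB; apply: eq_bigr => w _; rewrite mulrBr.
  field.
  by rewrite !gt_eqF.
have S1le : `|S1| <= n * (A * (h * m)).
  apply: ler_norm_sum_size => u /us1 u1.
  rewrite normrM ler_pM ?fA // distrC; exact: Kw.
have S3le : `|S3| <= m * (A * (h * n)).
  apply: ler_norm_sum_size => w /ws1 w1.
  rewrite normrM ler_pM ?fA //; exact: Ku.
have S2le : `|S2| <= n * (e * ((kap + h) * m) + m * (2 * A * (4 - d ^+ 2) ^+ N)).
  apply: ler_norm_sum_size => u /us1 u1.
  apply: le_trans (ler_norm_sum _ _ _) _.
  apply: (@le_trans _ _ (\sum_(w <- ws)
    (e * kernel N u w + 2 * A * (4 - d ^+ 2) ^+ N))).
    rewrite big_seq [leRHS]big_seq; apply: ler_sum => w /ws1 w1.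
    by rewrite normrM ger0_norm ?kernel_ge0 // far.
  rewrite big_split -mulr_sumr lerD //.
    rewrite ler_wpM2l // mulrDl -lerBlDl.
    exact: le_trans (ler_norm _) (Kw _ u1).
  by rewrite big_const_seq count_predT iter_addr_0 -[_ *+ size ws]mulr_natl.
rewrite -[X in X * `|_|]ger0_norm ?ler0n // -normrM split_ normrM.
rewrite ger0_norm ?invr_ge0 ?mulr_ge0 ?(ltW n0) ?(ltW m0) // ler_pdivrMl ?mulr_gt0 //.
apply: le_trans (ler_normD _ _) _.
apply: le_trans (lerD (ler_normD _ _) (lexx _)) _.
apply: le_trans (lerD (lerD S1le S2le) S3le) _.
rewrite le_eqVlt; apply/orP; left; apply/eqP; rewrite -/h; ring.
Qed.
End Discrepancy.

(** * Choosing the degree of the kernel *)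

(** The mean of the kernel loses only a linear factor against its maximum [4^N],
    whereas the kernel is exponentially smaller away from the diagonal. *)
Lemma central_binomial_ge N : (4 ^ N <= (2 * N).+1 * 'C(2 * N, N))%N.
Proof.
elim: N => // N IH.
have E : (N.+1 * 'C(2 * N.+1, N.+1) = 2 * (2 * N).+1 * 'C(2 * N, N))%N.
  have -> : (2 * N.+1 = (2 * N).+2)%N by lia.
  rewrite -(mul_bin_diag (2 * N).+2 N) /= -mulnA (mul_bin_down (2 * N).+1 N).
  have -> : ((2 * N).+1 - N = N.+1)%N by lia.
  by rewrite mulnA; congr (_ * _)%N; lia.
have : (4 * 4 ^ N <= 2 * (N.+1 * 'C(2 * N.+1, N.+1)))%N by rewrite E; nia.
rewrite expnS; nia.
Qed.

Section KernelChoice.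
Variable R : realType.

Lemma bernoulli (h : R) n : 0 <= h -> 1 + n%:R * h <= (1 + h) ^+ n.
Proof.
move=> h0; elim: n => [|n IH]; first by rewrite mul0r addr0 expr0.
rewrite exprS (le_trans _ (ler_wpM2l _ IH)) ?addr_ge0 //.
have : 0 <= n%:R * h * h by rewrite !mulr_ge0.
rewrite -natr1; lra.
Qed.

(** [1 - t <= (1 + t)^-1 <= (1 + t / 4)^-2], so Bernoulli's inequality gives a
    quadratic decay, which beats the linear factor. *)
Lemma linear_expr_small (t c : R) : 0 < t <= 1 -> 0 < c ->
  exists N, (2 * N).+1%:R * (1 - t) ^+ N <= c.
Proof.
move=> /andP[t0 t1] c0.
pose b := 3 * 16 / (t ^+ 2 * c).
have b0 : 0 <= b by rewrite divr_ge0 // mulr_ge0 ?sqr_ge0 // ltW.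
pose N := (Num.Def.truncn b).+1; exists N.
have Nb : b < N%:R by rewrite truncnS_gt.
have N0 : 1 <= N%:R :> R by rewrite ler1n.
have H : (1 - t) ^+ N * (1 + N%:R * (t / 4)) ^+ 2 <= 1.
  have t4 : 0 <= t / 4 by rewrite divr_ge0 // ltW.
  have B := bernoulli N t4.
  apply: (@le_trans _ _ ((1 - t) ^+ N * (1 + t) ^+ N)).
    rewrite ler_wpM2l ?exprn_ge0 ?subr_ge0 //.
    apply: (@le_trans _ _ (((1 + t / 4) ^+ N) ^+ 2)).
      rewrite lerXn2r ?nnegrE ?exprn_ge0 ?addr_ge0 //.
      by rewrite mulr_ge0.
    rewrite exprAC lerXn2r ?nnegrE ?exprn_ge0 ?addr_ge0 ?(ltW t0) //; nra.
  rewrite -exprMn exprn_ile1 //; nra.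
set p := (1 - t) ^+ N in H *.
have p0 : 0 <= p by rewrite exprn_ge0 // subr_ge0.
have Nc : 48 <= N%:R * (t ^+ 2 * c).
  by move/ltW: Nb; rewrite /b ler_pdivrMr ?mulr_gt0 ?exprn_gt0 //; lra.
have -> : (2 * N).+1%:R = 2 * N%:R + 1 :> R by rewrite -natr1 natrM.
apply: (@le_trans _ _ (3 * N%:R * p)); first by rewrite ler_wpM2r //; lra.
have H2 : p * (N%:R * N%:R * t ^+ 2) <= 16.
  have : 0 <= p * N%:R * t by rewrite !mulr_ge0 // ltW.
  move: H; rewrite expr2; nra.
have := ler_wpM2l (mulr_ge0 p0 (ler0n R N)) Nc.
have -> : p * N%:R * (N%:R * (t ^+ 2 * c)) = p * (N%:R * N%:R * t ^+ 2) * c by ring.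
have := ler_wpM2r (ltW c0) H2; lra.
Qed.

(** First the degree [N] makes the off-diagonal term small, then [eta] is chosen
    small compared to [4^-N]. *)
Theorem mean_discrepancy_small (A e d : R) : 0 <= A -> 0 < e -> 0 < d <= 1 ->
  exists (N : nat) (eta : R), 0 < eta /\
  forall (us ws : seq R[i]) (f : R[i] -> R),
  small_moments N eta us -> small_moments N eta ws ->
  (forall u, normc u = 1 -> `|f u| <= A) ->
  (forall u w, normc u = 1 -> normc w = 1 ->
     normc (u - w) < d -> `|f u - f w| <= e) ->
  `|(size us)%:R^-1 * \sum_(u <- us) f u -
    (size ws)%:R^-1 * \sum_(w <- ws) f w| <= 3 * e.
Proof.
move=> A0 e0 /[dup] d01 /andP[d0 d1].
have t01 : 0 < d ^+ 2 / 4 <= 1.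
  by rewrite divr_gt0 ?exprn_gt0 //= ler_pdivrMr // mul1r; nra.
have [|N HN] := @linear_expr_small (d ^+ 2 / 4) (e / (2 * A + 1)) t01.
  by rewrite divr_gt0 //; lra.
have p4 : 0 < 4 ^+ N :> R by rewrite exprn_gt0.
exists N, (e / (4 ^+ N * (2 * A + e))); split.
  by rewrite divr_gt0 // mulr_gt0 //; lra.
move=> us ws f mus mws fA fe.
have eta0 : 0 <= e / (4 ^+ N * (2 * A + e)).
  by rewrite divr_ge0 ?(ltW e0) // mulr_ge0 ?(ltW p4) //; lra.
have := mean_discrepancy eta0 mus mws A0 (ltW e0) d01 fA fe.
set kap : R := 'C(_, _)%:R; set X := `|_|.
have -> : e / (4 ^+ N * (2 * A + e)) * 4 ^+ N * (2 * A + e) = e.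
  by field; rewrite !gt_eqF //; lra.
have k1 : 1 <= kap by rewrite ler1n bin_gt0; lia.
have k4 : 4 ^+ N <= (2 * N).+1%:R * kap.
  by rewrite -natrX -natrM ler_nat central_binomial_ge.
have -> : (4 - d ^+ 2) ^+ N = 4 ^+ N * (1 - d ^+ 2 / 4) ^+ N.
  by rewrite -exprMn; congr (_ ^+ _); field.
set x := (1 - _) ^+ N in HN *.
have x0 : 0 <= x by rewrite exprn_ge0 // subr_ge0; case/andP: t01.
move=> H.
have : 2 * A * (4 ^+ N * x) <= kap * e.
  apply: (@le_trans _ _ (2 * A * kap * ((2 * N).+1%:R * x))).
    have := ler_wpM2r (mulr_ge0 x0 A0) k4; lra.
  apply: (@le_trans _ _ (2 * A * kap * (e / (2 * A + 1)))).
    by rewrite ler_wpM2l // !mulr_ge0 // (le_trans ler01).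
  rewrite [X in _ <= X](_ : _ = (2 * A + 1) * kap * (e / (2 * A + 1))).
    by rewrite ler_wpM2r ?divr_ge0 ?(ltW e0) //; lra.
  by field; rewrite gt_eqF //; lra.
have : e <= kap * e by rewrite ler_peMl // ltW.
move=> H1 H2; rewrite -(ler_pM2l (lt_le_trans ltr01 k1)); lra.
Qed.

End KernelChoice.

(** * Roots of unity and Riemann sums *)
Section CircleAverages.
Variable R : realType.

Lemma cexpiD (s t : R) : cexpi (s + t) = cexpi s * cexpi t.
Proof. by apply/eqP; rewrite eq_complex /= cosD sinD addrC eqxx /= addrC. Qed.

Lemma normc_cexpi (t : R) : normc (cexpi t) = 1.
Proof. by rewrite /cexpi /= cos2Dsin2 sqrtr1. Qed.

Lemma cexpi_natM (t : R) n : cexpi (n%:R * t) = cexpi t ^+ n.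
Proof.
elim: n => [|n IH]; first by rewrite mul0r expr0 /cexpi cos0 sin0.
by rewrite exprS -IH -cexpiD -natr1 mulrDl mul1r addrC.
Qed.

Lemma cexpi_neq1 (t : R) : 0 < t < 2 * pi -> cexpi t != 1.
Proof.
move=> /andP[t0 t1]; apply/eqP => /(congr1 (@complex.Re R)) /=.
have -> : t = t / 2 + t / 2 by field.
rewrite cosD -!expr2 cos2sin2 => H.
have : 0 < sin (t / 2) by apply: sin_gt0_pi; apply/andP; split; lra.
nra.
Qed.

Lemma cexpi_dist (s t : R) : normc (cexpi s - cexpi t) <= 2 * `|s - t|.
Proof.
wlog st : s t / s <= t.
  move=> H; case/orP: (le_total s t) => [/H//|/H].
  by rewrite normc_sub distrC.
have [c _ E1] : exists2 c : R, c \in `[s, t] & sin t - sin s = cos c * (t - s).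
  apply: (@MVT_segment R sin cos) => //.
  exact/continuous_subspaceT/continuous_sin.
have [d _ E2] : exists2 d : R, d \in `[s, t] & cos t - cos s = - sin d * (t - s).
  apply: (@MVT_segment R cos (fun x => - sin x)) => //.
  exact/continuous_subspaceT/continuous_cos.
rewrite normc_sub (le_trans (normc_le_ReIm _)) //= E1 E2.
rewrite !normrM [`|s - t|]distrC normrN mulr2n mulrDl mul1r.
have a1 : `|sin d| <= 1 by rewrite ler_norml sin_geN1 sin_le1.
have a2 : `|cos c| <= 1 by rewrite ler_norml cos_geN1 cos_le1.
by rewrite lerD // ler_piMl.
Qed.

(** Starting the subdivision at [- pi] makes the sums over the nodes Riemann
    sums over the interval of integration. *)
Definition circle_nodes (M : nat) : seq R[i] :=
  [seq cexpi (- pi + j%:R * (2 * pi / M%:R)) | j <- iota 0 M].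

Lemma size_circle_nodes M : size (circle_nodes M) = M.
Proof. by rewrite size_map size_iota. Qed.

Lemma circle_nodes_moments N eta M : (N < M)%N -> 0 <= eta ->
  small_moments N eta (circle_nodes M).
Proof.
move=> NM eta0; split.
- by rewrite size_circle_nodes; lia.
- by move=> u /mapP[j _ ->]; rewrite normc_cexpi.
move=> k /andP[k0 kN]; rewrite big_map.
have M0 : 0 < M%:R :> R by rewrite ltr0n; lia.
pose om := cexpi (2 * pi / M%:R : R) ^+ k.
under eq_bigr => j _ do rewrite cexpiD cexpi_natM exprMn exprAC -/om.
rewrite -mulr_sumr.
suff -> : \sum_(i <- iota 0 M) om ^+ i = 0.
  by rewrite mulr0 normc0 mulr_ge0.
have om1 : om != 1.
  rewrite /om -cexpi_natM cexpi_neq1 //; have := pi_gt0 R => pi0.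
  have kM : k%:R < M%:R :> R by rewrite ltr_nat; lia.
  have k0' : 0 < k%:R :> R by rewrite ltr0n.
  apply/andP; split; first by rewrite mulr_gt0 // divr_gt0 // mulr_gt0.
  by rewrite mulrA ltr_pdivrMr // mulrC ltr_pM2l // mulr_gt0.
have omM : om ^+ M = 1.
  rewrite /om exprAC -cexpi_natM mulrC divfK ?gt_eqF //.
  have -> : cexpi (2 * pi) = 1 :> R[i].
    rewrite mulr_natl /cexpi -[_ *+ 2]add0r cosD2pi sinD2pi cos0 sin0 //.
  by rewrite expr1n.
have := subrX1 om M; rewrite omM subrr => /esym/eqP.
rewrite mulf_eq0 subr_eq0 (negPf om1) /= => /eqP.
by rewrite -(big_mkord xpredT (fun i => om ^+ i)) /index_iota subn0.
Qed.

Notation mu := (@lebesgue_measure R).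

Lemma continuous_Rintegrable (g : R -> R) (a b : R) : continuous g ->
  mu.-integrable `[a, b] (EFin \o g).
Proof.
move=> cg; apply: continuous_compact_integrable; first exact: segment_compact.
exact: continuous_subspaceT.
Qed.

(** Induction on the number of pieces; on each piece the integrand stays within
    [e] of its value at the left end. *)
Lemma riemann_sum_dist (g : R -> R) (a h e : R) (M : nat) :
  continuous g -> 0 <= h ->
  (forall s t, `|s - t| <= h -> `|g s - g t| <= e) ->
  `|\int[mu]_(t in `[a, a + M%:R * h]) g t -
     \sum_(j <- iota 0 M) h * g (a + j%:R * h)| <= M%:R * h * e.
Proof.
move=> cg h0 ge; rewrite -[M in iota 0 M]subn0 -/(index_iota 0 M).
elim: M => [|M IH].
  rewrite !mul0r addr0 set_itv1 Rintegral_set1 big_geq // subrr normr0 //.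
rewrite big_nat_recr //=.
set b := a + M%:R * h in IH *; set c := a + M.+1%:R * h.
have cE : c = b + h by rewrite /c /b -natr1; ring.
have ab : a <= b by rewrite lerDl mulr_ge0.
have bc : b <= c by rewrite cE lerDl.
have split_ : \int[mu]_(t in `[a, c]) g t =
    \int[mu]_(t in `[a, b]) g t + \int[mu]_(t in `[b, c]) g t.
  have := @Rintegral_itvB R g (BLeft a) (BRight c) b
    (@continuous_Rintegrable g a c cg).
  rewrite !bnd_simp => /(_ ab bc).
  rewrite Rintegral_itv_obnd_cbnd; first by move=> <-; rewrite addrC subrK.
  apply: integrableS (@continuous_Rintegrable g b c cg) => //.
  by apply: subset_itvr; rewrite bnd_simp.
have aux (y z I : R) : I <= h * (y + z) -> h * (y - z) <= I ->
    `|I - h * y| <= h * z.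
  by move=> H1 H2; rewrite ler_norml; apply/andP; split; lra.
have piece : `|\int[mu]_(t in `[b, c]) g t - h * g b| <= h * e.
  have len (r : R) : \int[mu]_(t in `[b, c]) r = h * r.
    rewrite Rintegral_cst //= lebesgue_measure_itv /= lte_fin.
    case: ltP => bc'; last first.
      have h00 : h = 0 by lra.
      by rewrite h00 mulr0 mul0r.
    by rewrite cE -EFinB /= mulrC; congr (_ * _); ring.
  have ig : mu.-integrable `[b, c] (EFin \o g) by exact: continuous_Rintegrable.
  have ic (r : R) : mu.-integrable `[b, c] (EFin \o (fun=> r)).
    by apply: continuous_Rintegrable => ?; exact: cvg_cst.
  have near_ t : `[b, c]%classic t -> g b - e <= g t <= g b + e.
    rewrite /= in_itv /= => /andP[bt tc].
    have := ge t b; rewrite ger0_norm ?subr_ge0 // => /(_ _).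
    by rewrite ler_norml => H; have := H ltac:(lra) => /andP[]; lra.
  have up : \int[mu]_(t in `[b, c]) g t <= h * (g b + e).
    rewrite -len; apply: le_Rintegral => //; try exact: ic.
    by move=> t /near_ /andP[].
  have lo : h * (g b - e) <= \int[mu]_(t in `[b, c]) g t.
    rewrite -len; apply: le_Rintegral => //; try exact: ic.
    by move=> t /near_ /andP[].
  exact: aux.
rewrite split_ opprD addrACA (le_trans (ler_normD _ _)) //.
rewrite -natr1 mulrDl mul1r mulrDl lerD //.
Qed.

Lemma circle_nodes_mean (f : R[i] -> R) (e d : R) (M : nat) :
  continuous (f \o @cexpi R) -> 0 < d ->
  (forall u w, normc u = 1 -> normc w = 1 ->
     normc (u - w) < d -> `|f u - f w| <= e) ->
  4 * pi / d < M%:R ->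
  `|M%:R^-1 * \sum_(w <- circle_nodes M) f w -
     (2 * pi)^-1 * \int[mu]_(t in `[- pi, pi]) f (cexpi t)| <= e.
Proof.
move=> cf d0 fe Md; have pi0 := pi_gt0 R.
have M0 : 0 < M%:R :> R.
  by apply: le_lt_trans Md; rewrite divr_ge0 ?mulr_ge0 // ltW.
pose h : R := 2 * pi / M%:R.
have h0 : 0 < h by rewrite divr_gt0 // mulr_gt0.
have hd : 2 * h < d.
  by move: Md; rewrite ltr_pdivrMr // /h mulrA ltr_pdivrMr // mulrA; lra.
have Mh : M%:R * h = 2 * pi by rewrite /h mulrC divfK // gt_eqF.
have ge s t : `|s - t| <= h -> `|(f \o @cexpi R) s - (f \o @cexpi R) t| <= e.
  move=> st; apply: fe; rewrite ?normc_cexpi //.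
  by rewrite (le_lt_trans (cexpi_dist _ _)) //; lra.
have := riemann_sum_dist (- pi) M cf (ltW h0) ge.
rewrite Mh (_ : - pi + 2 * pi = pi); last by ring.
rewrite -mulr_sumr big_map -/h => H.
have -> : M%:R^-1 = (2 * pi)^-1 * h.
  by rewrite /h mulrA mulVf ?mul1r // gt_eqF // mulr_gt0.
rewrite -mulrA -mulrBr normrM distrC ger0_norm ?invr_ge0 ?mulr_ge0 ?(ltW pi0) //.
by rewrite ler_pdivrMl ?mulr_gt0.
Qed.

End CircleAverages.

(** * Test functions *)
Section TestFunctions.
Variable R : realType.

Lemma continuous_normcP (F : R[i] -> R[i]) : continuous F ->
  forall z (e : R), 0 < e -> exists2 d : R, 0 < d &
  forall w, normc (z - w) < d -> normc (F z - F w) < e.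
Proof.
move=> cF z e e0; have e0' : 0 < e%:C by rewrite ltcR.
have /cvgrPdist_lt /(_ _ e0') /nbhs_ballP [d /= d0 dF] := cF z.
exists (complex.Re d); first by move: d0; rewrite ltcE => /andP[].
move=> w zw; rewrite -ltc_normc; apply: dF.
rewrite -ball_normE /= (_ : d = (complex.Re d)%:C) ?ltc_normc //.
by rewrite RRe_real // gtr0_real.
Qed.

Lemma cvg_normc (T : Type) (G : set_system T) (F : T -> R[i]) (l : R[i]) :
  Filter G -> F @ G --> l -> normc (F t) @[t --> G] --> normc l.
Proof.
move=> FG Fl; apply/cvgrPdist_lt => e e0.
have e0' : 0 < e%:C by rewrite ltcR.
have H (a b : R[i]) : normc a - normc b <= normc (a - b).
  by rewrite lerBlDr -{1}[a](subrK b) normcD.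
have /cvgrPdist_lt /(_ _ e0') := Fl; apply: filterS => t.
rewrite ltc_normc; apply: le_lt_trans.
by rewrite ler_norml H andbT lerNl opprB normc_sub H.
Qed.

(** Compactness of a closed disc of the complex plane, in the form of a covering
    principle: a property that holds eventually around each point holds
    eventually on the whole disc.  It is deduced from the compactness of a
    square of [R * R]. *)
Lemma near_disc (T : Type) (G : set_system T) (P : T -> R[i] -> Prop) (B : R) :
  Filter G ->
  (forall z, exists2 d : R, 0 < d &
     \forall t \near G, forall w, normc (z - w) < d -> P t w) ->
  \forall t \near G, forall w, normc w <= B -> P t w.
Proof.
move=> FG loc.
have cB : compact (`[- B, B]%classic `*` `[- B, B]%classic : set (R * R)).
  by apply: compact_setX; exact: segment_compact.
have := (compact_near_coveringP _).1 cB T G (fun t p => P t (p.1 +i* p.2)) FG.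
move=> near_P; have {near_P} : \forall t \near G,
    `[- B, B]%classic `*` `[- B, B]%classic `<=` (fun p : R * R => P t (p.1 +i* p.2)).
  apply: near_P => -[a b] _ /=.
  have [d d0 dP] := loc (a +i* b).
  have d20 : 0 < d / 2 by rewrite divr_gt0.
  exists ((ball a (d / 2) `*` ball b (d / 2)),
          [set t | forall w, normc (a +i* b - w) < d -> P t w]).
    split => //; exists (ball a (d / 2), ball b (d / 2)) => //.
    by split; apply: nbhsx_ballx.
  move=> [[x y] t] /= [[ax byd] tP]; apply: tP.
  move: ax byd; rewrite -!ball_normE /= => ax by_.
  apply: (le_lt_trans (normc_le_ReIm ((a - x) +i* (b - y)))); rewrite /=; lra.
apply: filterS => t tP [x y] xyB; apply: (tP (x, y)).
have := le_trans (ler_Re_normc _) xyB; have := le_trans (ler_Im_normc _) xyB.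
by rewrite /= !ler_norml !in_itv.
Qed.

Lemma eig_test_bounded (F : R[i] -> R[i]) : eig_test F ->
  exists2 A : R, 0 <= A & forall z, normc (F z) <= A.
Proof.
move=> [/continuous_normcP cF [M [Mreal bF]]].
pose B := normc M + 1.
have out z : B < normc z -> F z = 0.
  move=> Bz; apply: contrapT => /eqP Fz.
  have : `|z| <= B%:C.
    apply: bF; last exact: subset_closure.
    rewrite -(RRe_real Mreal) ltcR /B (le_lt_trans (ler_norm _)) //.
    by rewrite (le_lt_trans (ler_Re_normc _)) // ltrDl.
  by rewrite normr_normc lecR leNgt Bz.
have : \forall A \near +oo, forall w, normc w <= B -> normc (F w) <= A.
  apply: near_disc => z; have [d d0 dF] := cF z 1 ltr01.
  exists d => //; near=> A => w /dF zw.
  have : normc (F w) <= normc (F z) + 1.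
    rewrite -[F w](subrK (F z)) (le_trans (normcD _ _)) // addrC lerD2l.
    by rewrite normc_sub ltW.
  by move/le_trans; apply; near: A; apply: nbhs_pinfty_ge; rewrite num_real.
move=> /(filterI (nbhs_pinfty_ge (num_real 0))) /filter_ex[A [A0 AF]].
exists A => // z; have [/AF//|Bz] := leP (normc z) B.
by rewrite out // normc0.
Unshelve. all: by end_near.
Qed.

(** Uniform continuity holds also for pairs with only one point on the circle,
    which is needed to move the zeros to the circle. *)
Lemma eig_test_unif_circle (F : R[i] -> R[i]) (e : R) : continuous F -> 0 < e ->
  exists2 d : R, 0 < d <= 1 & forall u w, normc u = 1 ->
    normc (u - w) < d -> normc (F u - F w) < e.
Proof.
move=> /continuous_normcP cF e0; have e2 : 0 < e / 2 by rewrite divr_gt0.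
have : \forall d \near 0^'+, forall u, normc u <= 1 -> forall w,
    normc (u - w) < d -> normc (F u - F w) < e.
  apply: near_disc => z; have [d d0 dF] := cF z _ e2.
  exists (d / 2); first by rewrite divr_gt0.
  near=> t => u zu w uw.
  have td : t < d / 2 by near: t; apply: nbhs_right_lt; rewrite divr_gt0.
  have zw : normc (z - w) < d.
    have -> : z - w = (z - u) + (u - w) by rewrite addrA subrK.
    rewrite (le_lt_trans (normcD _ _)) //; lra.
  have Fw := dF _ zw; have Fu : normc (F z - F u) < e / 2 by apply: dF; lra.
  have -> : F u - F w = (F u - F z) + (F z - F w) by rewrite addrA subrK.
  rewrite (le_lt_trans (normcD _ _)) // normc_sub; lra.
move=> H; have : \forall d \near (0 : R)^'+, 0 < d <= 1.
  by near=> d; apply/andP; split; near: d;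
    [exact: nbhs_right_gt | exact: nbhs_right_le].
move=> /(filterI H) /filter_ex[d [dF d01]]; exists d => // u w u1.
by apply: dF; rewrite u1.
Unshelve. all: by end_near.
Qed.

Lemma sv_test_bounded (F : R -> R[i]) : sv_test F ->
  exists2 A : R, 0 <= A & forall x, 0 <= x -> normc (F x) <= A.
Proof.
move=> [cF [M [_ bF]]].
pose B := `|M| + 1.
have out x : 0 <= x -> B < x -> F x = 0.
  move=> x0 Bx; apply: contrapT => /eqP Fx.
  have : `|x| <= B.
    apply: bF; last exact: subset_closure.
    by rewrite /B (le_lt_trans (ler_norm M)) // ltrDl.
  by rewrite ger0_norm // leNgt Bx.
have B0 : 0 <= B by rewrite addr_ge0.
have cF' : {within `[0, B], continuous F}.
  apply: continuous_subspaceW cF; apply: subset_itvl; rewrite bnd_simp //.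
have cnF : {within `[0, B], continuous (fun x => normc (F x))}.
  by move=> x; apply: cvg_normc; exact: (cF' x).
have [c _ cF''] := EVT_max B0 cnF.
exists (normc (F c)); first exact: normc_ge0.
move=> x x0; have [xB|Bx] := leP x B; first by apply: cF''; rewrite in_itv /= x0.
by rewrite out // normc0 normc_ge0.
Qed.

End TestFunctions.

(** * From moments to equidistribution *)
Section Equidistribution.
Variable R : realType.
Notation mu := (@lebesgue_measure R).

(** [ln x <= 2 sqrt x] suffices: an inequality between quadratic polynomials in
    [sqrt (n + 1)] remains. *)
Lemma log_le_linear (C e : R) : 0 < e ->
  \forall n \near \oo, C + C * ln n.+1%:R <= e * n%:R.
Proof.
move=> e0; pose X := (3 * `|C| + e) / e; have C0 := normr_ge0 C.
near=> n; have n1 : 0 < n.+1%:R :> R by rewrite ltr0n.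
pose x := Num.sqrt (n.+1%:R : R); have x2 : x ^+ 2 = n.+1%:R by rewrite sqr_sqrtr // ltW.
have x0 : 0 < x by rewrite sqrtr_gt0.
have x1 : 1 <= x by rewrite -sqrtr1 ler_wsqrtr // ler1n.
have Xx : X <= x.
  have Xn : X ^+ 2 <= n%:R by near: n; exact: nbhs_infty_ger.
  have X0 : 0 <= X by rewrite divr_ge0 ?addr_ge0 ?mulr_ge0 // ltW.
  rewrite -(@ler_pXn2r _ 2) ?nnegrE // ?ltW // x2 -natr1; lra.
have lnx : ln n.+1%:R <= 2 * x.
  by rewrite -x2 lnXn // -[leLHS]mulr_natl ler_pM2l // ltW // ln_sublinear.
have ln0 : 0 <= ln n.+1%:R :> R by rewrite ln_ge0 // ler1n.
apply: (@le_trans _ _ (`|C| + `|C| * (2 * x))).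
  rewrite lerD ?ler_norm // (le_trans (ler_norm _)) // normrM.
  by rewrite (ger0_norm ln0) ler_wpM2l.
have -> : n%:R = x ^+ 2 - 1 :> R by rewrite x2 -natr1 addrK.
have : (3 * `|C| + e) * x <= e * x ^+ 2.
  rewrite expr2 mulrA ler_wpM2r ?(ltW x0) //.
  by move: Xx; rewrite /X ler_pdivrMr // [x * e]mulrC.
nra.
Unshelve. all: by end_near.
Qed.

Lemma unitc_dist (z : R[i]) (d : R) : z != 0 -> 0 < d <= 1 ->
  d <= normc (unitc z - z) -> d / 2 <= `|ln (normc z)|.
Proof.
move=> z0 /andP[d0 d1]; set t := normc z.
have t0 : 0 < t by rewrite normc_gt0.
have lnle (y : R) : 0 < y -> ln y <= y - 1.
  move=> y0; have := @le_ln1Dx _ (y - 1).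
  by rewrite (_ : 1 + (y - 1) = y); [apply; lra | ring].
have -> : unitc z - z = unitc z * (1 - t)%:C.
  by rewrite rmorphB rmorph1 mulrBr mulr1 -unitcE.
rewrite normcM normc_unitc mul1r normc_real.
have [t1|t1] := leP t 1.
  rewrite ger0_norm ?subr_ge0 // ler0_norm ?ln_le0 //.
  have := lnle _ t0; lra.
rewrite ltr0_norm ?subr_lt0 // ger0_norm ?ln_ge0 ?(ltW t1) // => dt.
have := lnle t^-1; rewrite invr_gt0 lnV // => /(_ t0) H.
have : t^-1 <= 1 - d / 2.
  rewrite -[leLHS]mul1r ler_pdivrMr //; nra.
lra.
Qed.

(** The points are first moved to the circle, at a cost bounded by the sum of
    [|ln |z||]; the means over the circle are then compared with those over
    roots of unity, in number large enough for their moments up to [N] to vanish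
    and for the Riemann sum to be accurate. *)
Lemma zeros_mean_cvg (E : nat -> seq R[i]) (f : R[i] -> R) (A : R) :
  (forall n, size (E n) = n) ->
  (forall n, (1 < n)%N -> (count_mem 0%R (E n) <= 1)%N) ->
  (exists C : R, forall n, (1 < n)%N ->
     \sum_(z <- E n | z != 0) `|ln (normc z)| <= C + C * ln n.+1%:R) ->
  (forall k, exists C : R, forall n, (1 < n)%N ->
     normc (\sum_(z <- E n) unitc z ^+ k.+1) <= C + C * ln n.+1%:R) ->
  0 <= A -> (forall z, `|f z| <= A) ->
  continuous (f \o @cexpi R) ->
  (forall e, 0 < e -> exists2 d, 0 < d <= 1 & forall u w, normc u = 1 ->
     normc (u - w) < d -> `|f u - f w| <= e) ->
  n%:R^-1 * \sum_(z <- E n) f z @[n --> \oo] -->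
  (2 * pi)^-1 * \int[mu]_(t in `[- pi, pi]) f (cexpi t).
Proof.
move=> sE cE [K lnE] momE A0 fA cf unif.
apply/cvgrPdist_le => e0 e0_gt0.
have [e e_gt0 e0E] : exists2 e : R, 0 < e & e0 = 6 * e.
  by exists (e0 / 6); [rewrite divr_gt0 | field].
have [d d01 fd] := unif e e_gt0; have /andP[d0 d1] := d01.
have [N [eta [eta0 disc]]] := mean_discrepancy_small A0 e_gt0 d01.
(* The choice of N precedes that of n, so finitely many moments have to be
   small at the same time. *)
have moments_near N' : \forall n \near \oo, forall k, (k < N')%N ->
    normc (\sum_(z <- E n) unitc z ^+ k.+1) <= eta * n%:R.
  elim: N' => [|N' IH]; first by near=> n.
  have [C HC] := momE N'.
  near=> n => k; rewrite ltnS leq_eqVlt => /orP[/eqP->|]; last first.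
    by move: k; near: n.
  apply: (@le_trans _ _ (C + C * ln n.+1%:R)).
    by apply: HC; near: n; exact: nbhs_infty_gt.
  by near: n; exact: log_le_linear.
near=> n.
have n1 : (1 < n)%N by near: n; exact: nbhs_infty_gt.
have n0 : 0 < n%:R :> R by rewrite ltr0n ltnW.
pose us := [seq unitc z | z <- E n].
have sus : size us = n by rewrite size_map sE.
have us_mom : small_moments N eta us.
  split; first by rewrite sus ltnW.
    by move=> u /mapP[z _ ->]; rewrite normc_unitc.
  move=> [//|k] /= kN; rewrite sus big_map.
  by move: k kN; near: n; exact: moments_near.
pose M := (Num.Def.truncn (4 * pi / d) + N).+1.
have ws_mom : small_moments N eta (circle_nodes R M).
  by apply: circle_nodes_moments (ltW eta0); rewrite /M ltnS leq_addl.
have fd' u w : normc u = 1 -> normc w = 1 -> normc (u - w) < d ->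
   `|f u - f w| <= e by move=> u1 _; apply: fd.
have H1 := disc us (circle_nodes R M) f us_mom ws_mom (fun u _ => fA u) fd'.
have Md : 4 * pi / d < M%:R.
  by rewrite (lt_le_trans (truncnS_gt _)) // ler_nat /M ltnS leq_addr.
have H2 := circle_nodes_mean cf d0 fd' Md.
have H3 : `|n%:R^-1 * \sum_(z <- E n) f z - n%:R^-1 * \sum_(u <- us) f u| <= 2 * e.
  rewrite -mulrBr normrM ger0_norm ?invr_ge0 ?(ltW n0) // ler_pdivrMl //.
  rewrite big_map -sumrB.
  pose c := 4 * A / d; have c0 : 0 <= c by rewrite divr_ge0 ?mulr_ge0 // ltW.
  have fdist z : `|f z - f (unitc z)| <= 2 * A.
    by rewrite (le_trans (ler_normB _ _)) // mulr2n mulrDl mul1r lerD.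
  rewrite (bigID (fun z => z == 0)) /=.
  have Z0 : `|\sum_(z <- E n | z == 0) (f z - f (unitc z))| <= 2 * A.
    apply: le_trans (ler_norm_sum _ _ _) _.
    apply: (@le_trans _ _ (\sum_(z <- E n | z == 0) 2 * A)).
      by apply: ler_sum => z _.
    rewrite big_const_seq iter_addr_0.
    have := cE n n1; rewrite -[count (pred1 0%R) _]/(count (fun z => z == 0) _).
    case: (count _ _) => [|[|//]] _; last by rewrite mulr1n.
    by rewrite mulr0n mulr_ge0.
  have Z1 : `|\sum_(z <- E n | z != 0) (f z - f (unitc z))| <=
      e * n%:R + c * (K + K * ln n.+1%:R).
    apply: le_trans (ler_norm_sum _ _ _) _.
    apply: (@le_trans _ _ (\sum_(z <- E n | z != 0) (e + c * `|ln (normc z)|))).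
      apply: ler_sum => z z0.
      have [zd|zd] := ltP (normc (unitc z - z)) d.
        apply: ler_wpDr; first by rewrite mulr_ge0.
        by rewrite distrC; apply: fd => //; exact: normc_unitc.
      apply: ler_wpDl; first exact: ltW.
      rewrite (le_trans (fdist _)) //.
      have := ler_wpM2l c0 (unitc_dist z0 d01 zd).
      by rewrite (_ : c * (d / 2) = 2 * A) // /c; field; rewrite gt_eqF.
    rewrite big_split /= -[X in _ + X]mulr_sumr lerD //; last first.
      by rewrite ler_wpM2l // lnE.
    rewrite big_const_seq iter_addr_0 -[leLHS]mulr_natr ler_wpM2l ?(ltW e_gt0) //.
    by rewrite ler_nat -{2}(sE n) count_size.
  apply: le_trans (ler_normD _ _) _; apply: le_trans (lerD Z0 Z1) _.
  have : 2 * A + c * (K + K * ln n.+1%:R) <= e * n%:R; last by lra.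
  pose C := Num.max (2 * A + c * K) (c * K).
  have ln0 : 0 <= ln n.+1%:R :> R by rewrite ln_ge0 // ler1n.
  apply: (@le_trans _ _ (C + C * ln n.+1%:R)).
    rewrite mulrDr addrA mulrA lerD // ?ler_wpM2r // /C le_max lexx ?orbT //.
  by near: n; exact: log_le_linear.
move: H1 H2 H3; rewrite sus size_circle_nodes.
set a1 := _ * \sum_(u <- us) _; set a2 := _ * \sum_(w <- circle_nodes R M) _.
set a3 := _ * Rintegral _ _ _; set a4 := _ * \sum_(z <- E n) _.
move=> H1 H2 H3; have -> : e0 = e + 3 * e + 2 * e by rewrite e0E; ring.
have -> : a3 - a4 = (a3 - a2) + (a2 - a1) + (a1 - a4) by ring.
apply: le_trans (ler_normD _ _) _; rewrite lerD //; last by rewrite distrC.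
by apply: le_trans (ler_normD _ _) _; rewrite lerD // distrC.
Unshelve. all: by end_near.
Qed.

End Equidistribution.

(** * The spectra of the beta matrices *)
Section BetaSpectrum.
Variable R : realType.

Lemma cvg_ReIm (u : nat -> R[i]) (l : R[i]) :
  complex.Re (u n) @[n --> \oo] --> complex.Re l ->
  complex.Im (u n) @[n --> \oo] --> complex.Im l ->
  u n @[n --> \oo] --> l.
Proof.
move=> /cvgrPdist_lt cRe /cvgrPdist_lt cIm; apply/cvgrPdist_lt => e e0.
have eE : e = (complex.Re e)%:C by rewrite RRe_real // gtr0_real.
have e20 : 0 < complex.Re e / 2 by rewrite divr_gt0 // -ltcR -eE.
rewrite eE; near=> n; rewrite ltc_normc.
have R1 : `|complex.Re l - complex.Re (u n)| < complex.Re e / 2.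
  by near: n; exact: cRe.
have I1 : `|complex.Im l - complex.Im (u n)| < complex.Re e / 2.
  by near: n; exact: cIm.
apply: le_lt_trans (normc_le_ReIm _) _; move: R1 I1.
case: (u n) (l) => [a b] [c d] /=; lra.
Unshelve. all: by end_near.
Qed.

Lemma normc_beta_coef (beta : R[i]) k : 1 <= `|beta| ->
  normc (beta_coef beta k) <= k.+1%:R.
Proof.
rewrite normr_normc -[1]/(1%:C) lecR => b1.
rewrite /beta_coef (le_trans (normcD _ _)) // normc_opp normc1 -natr1 addrC.
rewrite lerD2r (le_trans (normc_sum _ _ _)) //.
apply: (@le_trans _ _ (\sum_(j < k) 1)); last by rewrite sumr_const card_ord.
apply: ler_sum => j _; rewrite normcV normcX invf_le1 ?exprn_ege1 //.
by rewrite exprn_gt0 // (lt_le_trans ltr01).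
Qed.

(** The bounds on the nonzero eigenvalues are uniform in [n] because the lowest
    nonzero coefficient, [c_1] or else [c_2 = -1], does not depend on [n].
    Since [c_1] and [c_2] never vanish together, 0 is at most a simple
    eigenvalue. *)
Lemma beta_zeros (beta : R[i]) : beta != 0 -> 1 <= `|beta| ->
  exists2 a : R, 0 < a <= 3 & forall n, (1 < n)%N ->
  let E := eigenvalues (beta_mx n beta) in
  let q := \prod_(z <- [seq z <- E | z != 0]) ('X - z%:P) in
  [/\ (count_mem 0%R E <= 1)%N, forall i, normc q`_i <= 3 * i.+1%:R &
      a <= normc q`_0].
Proof.
move=> b0 b1; pose c := beta_coef beta.
have c12 : c 1%N = 0 -> c 2%N = -1.
  rewrite /c /beta_coef !big_ord_recr !big_ord0 /= !add0r expr1 => /eqP.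
  rewrite subr_eq0 eq_sym invr_eq1 => /eqP->.
  by rewrite !expr1n invr1; ring.
pose a := if c 1%N == 0 then normc (c 2%N) else normc (c 1%N).
exists a.
  rewrite /a; case: eqP => [/c12->|/eqP c1].
    by rewrite normc_opp normc1 ltr01 ler1n.
  by rewrite normc_gt0 c1 (le_trans (normc_beta_coef _ b1)) // ler_nat.
move=> n n1 E q; set d := count_mem 0%R E.
have qE : beta_poly beta n = q * 'X^d.
  rewrite -char_poly_beta eigenvaluesP (bigID (fun z => z == 0)) /= mulrC /q big_filter.
  congr (_ * _); rewrite (eq_bigr (fun=> 'X)); last first.
    by move=> z /eqP->; rewrite subr0.
  by rewrite big_const_seq iter_mulr_1.
have coefE i : q`_i = (beta_poly beta n)`_(i + d).
  by rewrite qE coefMXn ltnNge leq_addl /= addnK.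
have q0 : q`_0 != 0.
  rewrite -horner_coef0 horner_prod prodf_seq_neq0; apply/allP => z.
  by rewrite mem_filter /= !hornerE oppr_eq0 => /andP[].
have d1 : (d <= 1)%N.
  rewrite leqNgt; apply/negP => d2.
  have low i : (i < 2)%N -> c i.+1 = 0.
    move=> i2; have := coef_beta_poly beta n i.
    by rewrite (leq_trans i2 n1) qE coefMXn (leq_trans i2 d2) /c => <-.
  by have := c12 (low 0%N isT); rewrite low // => /esym/eqP; rewrite oppr_eq0 oner_eq0.
split=> // [i|].
  rewrite coefE coef_beta_poly; case: ifP => _.
    rewrite (le_trans (normc_beta_coef _ b1)) // -natrM ler_nat; lia.
  rewrite normc_nat -natrM ler_nat; case: eqP => _; lia.
move: q0; rewrite coefE add0n coef_beta_poly (leq_ltn_trans d1 n1) -/c.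
have [dz|dpos] := posnP d.
  by rewrite dz /a; case: eqP => // ->; rewrite eqxx.
have dE : d = 1%N by apply/eqP; rewrite eqn_leq d1.
have c10 : c 1%N = 0.
  have := coef_beta_poly beta n 0.
  by rewrite (ltnW n1) qE coefMXn dpos /c => <-.
by rewrite dE /a c10 eqxx.
Qed.

(** Here [p] stands for the real or the imaginary part, which reduces complex
    test functions to real ones. *)
Theorem beta_eig_cvg (beta : R[i]) (F : R[i] -> R[i]) (p : R[i] -> R) :
  beta != 0 -> 1 <= `|beta| -> eig_test F ->
  (forall x y, p (x - y) = p x - p y) -> (forall x, `|p x| <= normc x) ->
  n%:R^-1 * \sum_(z <- eigenvalues (beta_mx n beta)) p (F z) @[n --> \oo] -->
  (2 * pi)^-1 * \int[@lebesgue_measure R]_(t in `[- pi, pi]) p (F (cexpi t)).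
Proof.
move=> b0 b1 Ft pB pn; have [a a3 zeros] := beta_zeros b0 b1.
have [A A0 FA] := eig_test_bounded Ft.
have logs n (s : seq R[i]) : (size s <= n)%N ->
    ln (size s).+1%:R <= ln n.+1%:R :> R.
  by move=> sn; rewrite ler_ln ?posrE ?ltr0n // ler_nat.
have ln0 n : 0 <= ln n.+1%:R :> R by rewrite ln_ge0 // ler1n.
have size_nz n (E := eigenvalues (beta_mx n beta)) :
    (size [seq z <- E | z != 0%R] <= n)%N.
  by rewrite size_filter -[leqRHS](size_eigenvalues (beta_mx n beta)) count_size.
apply: (@zeros_mean_cvg R (fun n => eigenvalues (beta_mx n beta)) (p \o F) A).
- by move=> n; exact: size_eigenvalues.
- by move=> n /zeros[].
- pose K := Num.max (ln (3 ^+ 2) - ln a) 3.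
  exists K => n /zeros[_ qc qa].
  rewrite -big_filter; apply: le_trans (sum_abs_ln_roots a3 qc qa) _.
  rewrite lerD // /K ?le_max ?lexx //.
  apply: (@le_trans _ _ (3 * ln n.+1%:R)); first by rewrite ler_wpM2l // logs.
  by rewrite ler_wpM2r // le_max lexx orbT.
- move=> k; have [C HC] := unitc_moment_bound a3 k.
  exists (1 + `|C|) => n /zeros[d1 qc qa].
  rewrite (bigID (fun z => z == 0)) /= (le_trans (normcD _ _)) //.
  have Z0 : normc (\sum_(z <- eigenvalues (beta_mx n beta) | z == 0)
      unitc z ^+ k.+1) <= 1.
    rewrite (eq_bigr (fun=> 1)); last first.
      by move=> z /eqP->; rewrite /unitc eqxx expr1n.
    by rewrite big_const_seq iter_addr_0 normc_nat lern1.
  apply: le_trans (lerD Z0 (lexx _)) _.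
  rewrite -big_filter; apply: le_trans (lerD (lexx _) (HC _ qc qa)) _.
  have H1 := logs _ _ (size_nz n); have H2 := ler_norm C.
  have H3 := ln0 (size [seq z <- eigenvalues (beta_mx n beta) | z != 0]).
  have := ler_wpM2r H3 H2; have := ler_wpM2l (normr_ge0 C) H1; have := ln0 n.
  lra.
- exact: A0.
- by move=> z /=; rewrite (le_trans (pn _)).
- move=> t; apply/cvgrPdist_lt => e e0.
  have [d d0 dF] := continuous_normcP Ft.1 (cexpi t) e0.
  apply/nbhs_ballP; exists (d / 2) => /=; first by rewrite divr_gt0.
  move=> s /= ts.
  rewrite -pB (le_lt_trans (pn _)) // dF //.
  rewrite (le_lt_trans (cexpi_dist _ _)) //; lra.
move=> e e0; have [d d01 dF] := eig_test_unif_circle Ft.1 e0.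
exists d => // u w u1 uw /=; rewrite -pB (le_trans (pn _)) // ltW // dF //.
Qed.

Lemma Re_mulC (a : R) (z : R[i]) : complex.Re (a%:C * z) = a * complex.Re z.
Proof. by case: z => x y /=; rewrite mul0r subr0. Qed.

Lemma Im_mulC (a : R) (z : R[i]) : complex.Im (a%:C * z) = a * complex.Im z.
Proof. by case: z => x y /=; rewrite mul0r addr0. Qed.

Lemma natCV n : n%:R^-1 = (n%:R^-1)%:C :> R[i].
Proof. by rewrite fmorphV rmorph_nat. Qed.

Lemma Re_sum (s : seq R[i]) (F : R[i] -> R[i]) :
  complex.Re (\sum_(z <- s) F z) = \sum_(z <- s) complex.Re (F z).
Proof. by apply: big_morph => // -[x y] [x' y']. Qed.

Lemma Im_sum (s : seq R[i]) (F : R[i] -> R[i]) :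
  complex.Im (\sum_(z <- s) F z) = \sum_(z <- s) complex.Im (F z).
Proof. by apply: big_morph => // -[x y] [x' y']. Qed.

Lemma circle_mean_cst (c : R[i]) : circle_mean (fun _ : R => c) = c.
Proof.
have pi0 := pi_gt0 R.
have I (r : R) : \int[@lebesgue_measure R]_(t in `[- pi, pi]) r = r * (2 * pi).
  rewrite Rintegral_cst //= lebesgue_measure_itv /= lte_fin ifT; last lra.
  by rewrite -EFinB /=; congr (_ * _); ring.
have p2 : 2 * pi != 0 :> R by rewrite gt_eqF // mulr_gt0.
rewrite /circle_mean /Cintegral !I; case: c => x y; simpc => /=.
by congr (_ +i* _); rewrite mulrC mulfK.
Qed.

Lemma beta_sv_cvg (beta : R[i]) (F : R -> R[i]) : sv_test F ->
  sv_mean (beta_mx n beta) F @[n --> \oo] --> F 1.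
Proof.
move=> /sv_test_bounded[A A0 FA].
apply/cvgrPdist_lt => e e0.
have eE : e = (complex.Re e)%:C by rewrite RRe_real // gtr0_real.
have {}e0 : 0 < complex.Re e by rewrite -ltcR -eE.
rewrite eE; near=> n; rewrite ltc_normc.
have n0 : (0 < n)%N by near: n; exact: nbhs_infty_gt.
have n0R : 0 < n%:R :> R by rewrite ltr0n.
set B := beta_mx n beta; set E := eigenvalues (B ^t* *m B)%sesqui.
pose g (z : R[i]) := F 1 - F (Num.sqrt (complex.Re z)).
have -> : F 1 - sv_mean B F = n%:R^-1 * \sum_(z <- E) g z.
  rewrite sumrB mulrBr /sv_mean /singular_values big_map; congr (_ - _).
  rewrite big_const_seq count_predT iter_addr_0 size_eigenvalues -[F 1 *+ n]mulr_natl.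
  by rewrite mulKf // pnatr_eq0 -lt0n.
have cnt : (count (fun z => z != 1%R) E <= 3)%N.
  have H := count_eigenvalues_rank (B ^t* *m B)%sesqui 1.
  have := leq_trans H (leq_add (leqnn _) (rank_beta_gram n beta)).
  have := count_predC (pred1 1%R) E; rewrite size_eigenvalues -/E.
  rewrite -[count (fun z => z != 1%R) E]/(count (predC (pred1 1%R)) E).
  set m1 := count_mem _ _; set m2 := count (predC _) _; lia.
have gA z : normc (g z) <= 2 * A.
  rewrite (le_trans (normcD _ _)) // normc_opp mulr2n mulrDl mul1r lerD //.
    exact: FA.
  by rewrite FA // sqrtr_ge0.
have bound : normc (\sum_(z <- E) g z) <= 3 * (2 * A).
  rewrite (bigID (fun z => z == 1)) /= big1 ?add0r; last first.
    by move=> z /eqP->; rewrite /g /= sqrtr1 subrr.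
  apply: le_trans (normc_sum _ _ _) _.
  apply: (@le_trans _ _ (\sum_(z <- E | z != 1) 2 * A)).
    by apply: ler_sum => z _.
  rewrite big_const_seq iter_addr_0 -[leLHS]mulr_natl ler_wpM2r ?mulr_ge0 //.
  by rewrite ler_nat.
rewrite normcM normcV normc_nat ltr_pdivrMl // (le_lt_trans bound) //.
rewrite -ltr_pdivrMr //.
by near: n; exact: nbhs_infty_gtr.
Unshelve. all: by end_near.
Qed.

End BetaSpectrum.

Theorem theorem5p1 (R : realType) (beta : R[i]) (beta_neq0 : beta != 0) :
  (1 <= `|beta| ->
     eig_distributed (fun n => beta_mx n beta) (fun t : R => cexpi t)) /\
  (sv_distributed (fun n => beta_mx n beta) (fun _ : R => 1) /\
   forall F : R -> R[i], sv_test F ->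
     circle_mean (fun _ : R => F 1) = F 1 /\
     sv_mean (beta_mx n beta) F @[n --> \oo] --> F 1).
Proof.
split; last split.
- move=> b1 F Ft; apply: cvg_ReIm.
    rewrite /circle_mean Re_mulC /=.
    under eq_fun do rewrite /eig_mean natCV Re_mulC Re_sum.
    apply: (@beta_eig_cvg R beta F (@complex.Re R)) => //.
    - by move=> [x y] [x' y'].
    - exact: ler_Re_normc.
  rewrite /circle_mean Im_mulC /=.
  under eq_fun do rewrite /eig_mean natCV Im_mulC Im_sum.
  apply: (@beta_eig_cvg R beta F (@complex.Im R)) => //.
  - by move=> [x y] [x' y'].
  - exact: ler_Im_normc.
- move=> F Ft; rewrite normr1 circle_mean_cst; exact: beta_sv_cvg.
- by move=> F Ft; split; [exact: circle_mean_cst | exact: beta_sv_cvg].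
Qed.
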